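(* Assume: $f=F\circ G$ is convex and $h$ is $\mu$-strongly convex with $\mu>0$; every $F_i$ is $L_F$-smooth with $B_F$-bounded gradient and every $G_j$ is $L_G$-smooth with $B_G$-bounded Jacobian; $\|[\nabla G_j(x)]^\top\nabla F_i(G(x))-[\nabla G_j(y)]^\top\nabla F_i(G(y))\|\le L\|x-y\|$ for all $i\in[n_1]$, $j\in[n_2]$ and $x,y\in\mathbb R^{N_2}$; and $L\ge\mu$. Let $x^*$ be the minimizer of $H=f+h$ and let $\varepsilon>0$. Run SoCK with Option I from $x_0$ with $$m=\left\lceil \tfrac12\sqrt{L/\mu}\right\rceil,\quad \tau_1=\tau_2=\frac1{2m},\quad \theta=1+\frac1{12m},\quad \alpha=\frac1{3\tau_1L},\quad A=\frac{720B_G^4L_F^2}{\mu^2},\quad B=\frac{720B_F^2L_G^2}{\mu^2}$$ ($A,B$ rounded up to the nearest positive integer). Then, with a suitable number $S$ of outer loops, the output $\widetilde x^S$ is a stochastic $\varepsilon$-solution, i.e. $\mathbb E[H(\widetilde x^S)-H(x^* )]\le\varepsilon$, and the total complexity is $$O\left(\left(n_1+n_2+\sqrt{\frac L\mu}\Big(\frac{\max\{B_G^4L_F^2,\,B_F^2L_G^2\}}{\mu^2}+n_1\Big)\right)\log\frac{H(x_0)-H(x^* )}{\varepsilon}\right),$$ where the constant in $O(\cdot)$ is universal.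
   Context: Problem: $\min_{x\in\mathbb R^{N_2}}H(x)=f(x)+h(x)$ with $f=F\circ G$, $F=\frac1{n_1}\sum_{i=1}^{n_1}F_i$, $G=\frac1{n_2}\sum_{j=1}^{n_2}G_j$, where $F_i:\mathbb R^{N_1}\to\mathbb R$ and $G_j:\mathbb R^{N_2}\to\mathbb R^{N_1}$ are differentiable and $h:\mathbb R^{N_2}\to\mathbb R\cup\{+\infty\}$ is a proper closed convex function. $\nabla$ denotes the gradient of a scalar function and the Jacobian matrix of a vector-valued map; $\|\cdot\|$ is the Euclidean norm of vectors and the spectral norm of matrices; $[n]=\{1,\dots,n\}$. A differentiable map $\phi$ is $l$-smooth if $\|\nabla\phi(x)-\nabla\phi(x')\|\le l\|x-x'\|$ for all $x,x'$; it has $b$-bounded gradient/Jacobian if $\|\nabla\phi(x)\|\le b$ for all $x$. $h$ is $\mu$-strongly convex if $h(x')\ge h(x)+\langle g,x'-x\rangle+\frac\mu2\|x'-x\|^2$ for every $x,x'$ and every subgradient $g$ of $h$ at $x$. Algorithm SoCK (Option I). Inputs: $x_0\in\mathbb R^{N_2}$ with $h(x_0)<\infty$, positive integers $S,m,A,B$, reals $\theta>1$, $\alpha>0$, $\tau_1,\tau_2$. Set $y_0=z_0=\widetilde x^0=x_0$. For $s=0,\dots,S-1$: compute $G(\widetilde x^s)$, $\nabla G(\widetilde x^s)$, $\nabla f(\widetilde x^s)$; for $j=0,\dots,m-1$, put $k=sm+j$ and (1) $x_{k+1}=\tau_1z_k+\tau_2\widetilde x^s+(1-\tau_1-\tau_2)y_k$;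 (2) draw multisets $\mathcal A_k,\mathcal B_k$ uniformly at random with replacement from $[n_2]$, with $|\mathcal A_k|=A$, $|\mathcal B_k|=B$ (all draws mutually independent); (3) $\widehat G_k=\frac1A\sum_{i\in\mathcal A_k}(G_i(x_{k+1})-G_i(\widetilde x^s))+G(\widetilde x^s)$ and $\nabla\widehat G_k=\frac1B\sum_{i\in\mathcal B_k}(\nabla G_i(x_{k+1})-\nabla G_i(\widetilde x^s))+\nabla G(\widetilde x^s)$; (4) $\widetilde\nabla_{k+1}=[\nabla\widehat G_k]^\top\nabla F(\widehat G_k)$; (5) $z_{k+1}=\arg\min_z\{\langle\widetilde\nabla_{k+1},z\rangle+\frac1{2\alpha}\|z-z_k\|^2+h(z)\}$; (6) $y_{k+1}=\arg\min_y\{\langle\widetilde\nabla_{k+1},y\rangle+\frac{3L}2\|y-x_{k+1}\|^2+h(y)\}$. After the inner loop, $\widetilde x^{s+1}=\big(\sum_{j=0}^{m-1}\theta^j\big)^{-1}\sum_{j=0}^{m-1}\theta^jy_{sm+j+1}$. The output is $\widetilde x^S$. Complexity is the total number of evaluations of the component quantities $\nabla F_i$, $G_j$, $\nabla G_j$ and of the proximal mapping of $h$ (steps (5), (6) use one each). Per outer loop, the component evaluations number $n_1+2n_2+m(2A+2B+n_1)$. In the complexity bound, $\log(\cdot)$ is read as $\max\{1,\log(\cdot)\}$. *)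

(* Defs.v *)
From HB Require Import structures.
From mathcomp Require Import all_boot all_order all_algebra.
From mathcomp Require Import all_classical all_reals all_analysis.

Set Implicit Arguments.
Unset Strict Implicit.
Unset Printing Implicit Defensive.

Import Order.TTheory GRing.Theory Num.Theory.
Import numFieldNormedType.Exports.

Local Open Scope classical_set_scope.
Local Open Scope ring_scope.

(* Vectors of R^n are row vectors.  The library's Jacobian ['J G x] of
   [G : 'rV_n -> 'rV_p] is the n x p matrix with ['d G x v = v *m 'J G x],
   i.e. the transpose of the column-vector Jacobian, and the vector
   [nabla G]^T (nabla F) reads [grad F u *m ('J G x)^T]. *)

(* The library's norm on matrices is the sup norm, hence [enorm]; it induces
   the same topology, so that [differentiable] is the usual notion. *)
Definition dotv {R : realType} {n : nat} (u v : 'rV[R]_n) : R :=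
  \sum_(i < n) u 0 i * v 0 i.

Definition enorm {R : realType} {n : nat} (v : 'rV[R]_n) : R :=
  Num.sqrt (dotv v v).

(* Invariant under transposition, so insensitive to the row convention. *)
Definition spectral_norm {R : realType} {n p : nat} (M : 'M[R]_(n, p)) : R :=
  sup [set enorm (v *m M) | v in [set v : 'rV[R]_n | enorm v <= 1]].

Definition grad {R : realType} {n : nat} (F : 'rV[R]_n -> R) (x : 'rV[R]_n) :
    'rV[R]_n :=
  \row_(i < n) 'D_(delta_mx 0 i) F x.

Definition smooth_fun {R : realType} {n : nat} (l : R) (F : 'rV[R]_n -> R) :=
  forall x x', enorm (grad F x - grad F x') <= l * enorm (x - x').

Definition bounded_grad {R : realType} {n : nat} (b : R) (F : 'rV[R]_n -> R) :=
  forall x, enorm (grad F x) <= b.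

Definition smooth_map {R : realType} {n p : nat} (l : R)
    (G : 'rV[R]_n -> 'rV[R]_p) :=
  forall x x', spectral_norm ('J G x - 'J G x') <= l * enorm (x - x').

Definition bounded_jacobian {R : realType} {n p : nat} (b : R)
    (G : 'rV[R]_n -> 'rV[R]_p) :=
  forall x, spectral_norm ('J G x) <= b.

Definition proper_fun {R : realType} {n : nat} (h : 'rV[R]_n -> \bar R) :=
  (forall x, (-oo < h x)%E) /\ (exists x, (h x < +oo)%E).

(* For [h] never [-oo] there is no [+oo - oo] here, and [0 * +oo = 0]. *)
Definition ext_convex {R : realType} {n : nat} (h : 'rV[R]_n -> \bar R) :=
  forall (x y : 'rV[R]_n) (t : R), 0 <= t <= 1 ->
    (h (t *: x + (1 - t) *: y)%R
       <= t%:E * h x + (1 - t)%:E * h y)%E.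

Definition subgradient {R : realType} {n : nat} (h : 'rV[R]_n -> \bar R)
    (x g : 'rV[R]_n) :=
  forall x', (h x + (dotv g (x' - x))%:E <= h x')%E.

Definition strongly_convex {R : realType} {n : nat} (mu : R)
    (h : 'rV[R]_n -> \bar R) :=
  forall x x' g, subgradient h x g ->
    (h x + (dotv g (x' - x) + mu / 2 * enorm (x' - x) ^+ 2)%:E <= h x')%E.

Definition minimizer {R : realType} {n : nat} (phi : 'rV[R]_n -> \bar R)
    (x : 'rV[R]_n) :=
  forall x', (phi x <= phi x')%E.

(* The default value 0 is only used when there is no minimizer. *)
Definition argmin {R : realType} {n : nat} (phi : 'rV[R]_n -> \bar R) :
    'rV[R]_n :=
  xget 0 [set x | minimizer phi x].

Definition expectation_unif {R : realType} (T : finType) (X : T -> \bar R) :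
    \bar R :=
  ((#|T|%:R^-1)%:E * \sum_(t : T) X t)%E.

Definition avg_fun {R : realType} {n1 N1 : nat}
    (Fi : 'I_n1 -> 'rV[R]_N1 -> R) (u : 'rV[R]_N1) : R :=
  n1%:R^-1 * \sum_(i < n1) Fi i u.

Definition avg_map {R : realType} {n2 N1 N2 : nat}
    (Gj : 'I_n2 -> 'rV[R]_N2 -> 'rV[R]_N1) (x : 'rV[R]_N2) : 'rV[R]_N1 :=
  n2%:R^-1 *: \sum_(j < n2) Gj j x.

Section SoCK.

Context {R : realType} {n1 n2 N1 N2 : nat}.
Variables (Fi : 'I_n1 -> 'rV[R]_N1 -> R)
          (Gj : 'I_n2 -> 'rV[R]_N2 -> 'rV[R]_N1)
          (h : 'rV[R]_N2 -> \bar R).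

Definition smooth_part : 'rV[R]_N2 -> R := avg_fun Fi \o avg_map Gj.

Definition objective (x : 'rV[R]_N2) : \bar R := ((smooth_part x)%:E + h x)%E.

Variables (L tau1 tau2 theta alpha : R) (m A B : nat).

(* The two multisets drawn at one inner iteration, as sequences of draws. *)
Definition draw : finType := (A.-tuple 'I_n2 * B.-tuple 'I_n2)%type.

(* From the snapshot [xt] and [(y_k, z_k)] to [(y_{k+1}, z_{k+1})]. *)
Definition sock_step (xt : 'rV[R]_N2) (yz : 'rV[R]_N2 * 'rV[R]_N2) (w : draw) :
    'rV[R]_N2 * 'rV[R]_N2 :=
  let: (y, z) := yz in
  let x := tau1 *: z + tau2 *: xt + (1 - tau1 - tau2) *: y in
  let Ghat := A%:R^-1 *: (\sum_(i <- w.1) (Gj i x - Gj i xt))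
              + avg_map Gj xt in
  let JGhat := B%:R^-1 *: (\sum_(i <- w.2) ('J (Gj i) x - 'J (Gj i) xt))
               + 'J (avg_map Gj) xt in
  let d := grad (avg_fun Fi) Ghat *m JGhat^T in
  let z' := argmin (fun u =>
    ((dotv d u + (2 * alpha)^-1 * enorm (u - z) ^+ 2)%:E + h u)%E) in
  let y' := argmin (fun u =>
    ((dotv d u + 3 * L / 2 * enorm (u - x) ^+ 2)%:E + h u)%E) in
  (y', z').

(* State: the snapshot and the pair [(y, z)], which is carried over from one
   outer loop to the next.  The item [j] of [tr] is
   [(y_{sm+j+1}, z_{sm+j+1})]. *)
Definition sock_epoch (st : 'rV[R]_N2 * ('rV[R]_N2 * 'rV[R]_N2))
    (ws : m.-tuple draw) : 'rV[R]_N2 * ('rV[R]_N2 * 'rV[R]_N2) :=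
  let: (xt, yz) := st in
  let tr := scanl (sock_step xt) yz ws in
  ((\sum_(j < m) theta ^+ j)^-1 *: \sum_(j < m) theta ^+ j *: (nth yz tr j).1,
   last yz tr).

Definition sock_sample (S : nat) : finType := S.-tuple (m.-tuple draw).

Definition sock (x0 : 'rV[R]_N2) (S : nat) (w : sock_sample S) : 'rV[R]_N2 :=
  (foldl sock_epoch (x0, (x0, x0)) w).1.

End SoCK.

(* One outer loop: [n2] values and [n2] Jacobians of the [Gj], [n1] gradients
   of the [Fi]; then, for each of the [m] inner iterations, [2 * A] values and
   [2 * B] Jacobians of the [Gj], [n1] gradients of the [Fi] and 2 proximal
   mappings of [h]. *)
Definition sock_complexity (n1 n2 m A B S : nat) : nat :=
  (S * ((n2 + n2 + n1) + m * (2 * A + 2 * B + n1 + 2)))%N.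

Definition ceil_nat {R : realType} (x : R) : nat := `|Num.ceil x|%N.

(* Main.v *)
(* Katyusha with biased gradients.  With [D] the optimality gap and [Z] the
   squared distance to the minimizer, one inner iteration satisfies, pathwise,
   D(y') + tau (3 tau L + mu) / 2 * Z(z')
     <= tau D(xt) + (1 - 2 tau) D(y) + 3 tau^2 L / 2 * Z(z)
        + |e|^2 / (4 L) - tau <e, z - xstar>,
   where [e] is the error of the gradient estimator.  The bias is not removed:
   Young's inequality charges [<e, z - xstar>] to the strong convexity of [h],
   and the batch sizes make E|e|^2 at most mu^2 / 180 * |x - xt|^2, which strong
   convexity again bounds by the gaps and [Z].  A geometrically weighted sum over
   an epoch then shows that a combination of [D(xt)], [D(y)] and [Z(z)] shrinks by
   the factor [theta ^ m >= 13 / 12] in expectation.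

   Subgradients of [h] are only needed at minimizers of [q + h] with [q]
   differentiable, where [- grad q] is one; so no existence theorem for
   subgradients is used. *)

Require Import Defs.
From HB Require Import structures.
From mathcomp Require Import all_boot all_order all_algebra.
From mathcomp Require Import finmap.
From mathcomp Require Import all_classical all_reals all_analysis.
From mathcomp Require Import ring lra.

Set Implicit Arguments.
Unset Strict Implicit.
Unset Printing Implicit Defensive.

Import Order.TTheory GRing.Theory Num.Theory.
Import numFieldNormedType.Exports.

Local Open Scope classical_set_scope.
Local Open Scope ring_scope.

(** * Euclidean and spectral norms *)

(** The prox weights are dictated by cancellation. The [3 * L / 2] of the [y] step is [L / 2] from
    the descent lemma plus [L] from Young's inequality on the estimator error, and
    [alpha = (3 * tau * L)^-1] makes the [|z' - z|^2] terms of the two prox inequalities cancel.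
    Strong convexity then leaves a surplus [tau * mu / 2] in the coefficient of [Z(z')], spent in
    three shares of [tau * mu]: an eighth on the bias, a quarter on the growth of
    [3 * tau^2 * L / 2] by the factor [theta], an eighth on the variance and lower-order terms. The
    choice of [m] serves twice: [tau^2 * L <= mu] bounds the second share, and [mu <= 3 * tau * L]
    makes [(4 * L)^-1 * |e|^2] at most comparable to the bias term [2 * tau / mu * |e|^2]. Since
    [theta - 1 = tau / 6] and [m * tau = 1 / 2], the factor [theta ^ m] lies between [13 / 12] and
    [12 / 11]: enough for a fixed gain per epoch, little enough for the snapshot coefficient to be
    paid by the decrease of [D(y)]. *)

Section Euclidean.
Context {R : realType} {n : nat}.
Implicit Types (u v w : 'rV[R]_n) (a b : R).

Lemma dotvE u v : dotv u v = (u *m v^T) 0 0.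
Proof. by rewrite mxE; apply: eq_bigr => i _; rewrite mxE. Qed.

Lemma dotvC u v : dotv u v = dotv v u.
Proof. by apply: eq_bigr => i _; rewrite mulrC. Qed.

Lemma dotvDl u v w : dotv (u + v) w = dotv u w + dotv v w.
Proof. by rewrite !dotvE mulmxDl mxE. Qed.

Lemma dotvZl a u w : dotv (a *: u) w = a * dotv u w.
Proof. by rewrite !dotvE -scalemxAl mxE. Qed.

Lemma dotvNl u w : dotv (- u) w = - dotv u w.
Proof. by rewrite -scaleN1r dotvZl mulN1r. Qed.

Lemma dotvDr u v w : dotv w (u + v) = dotv w u + dotv w v.
Proof. by rewrite !(dotvC w) dotvDl. Qed.

Lemma dotvZr a u w : dotv w (a *: u) = a * dotv w u.
Proof. by rewrite !(dotvC w) dotvZl. Qed.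

Lemma dotvNr u w : dotv w (- u) = - dotv w u.
Proof. by rewrite !(dotvC w) dotvNl. Qed.

Definition dotv_lin := (dotvDl, dotvDr, dotvZl, dotvZr, dotvNl, dotvNr).

Lemma dotv0l w : dotv 0 w = 0.
Proof. by rewrite -(scale0r 0) dotvZl mul0r. Qed.

Lemma dotv_sumr (I : Type) (r : seq I) (F : I -> 'rV[R]_n) w :
  dotv w (\sum_(i <- r) F i) = \sum_(i <- r) dotv w (F i).
Proof.
elim: r => [|i r IH]; first by rewrite !big_nil dotvC dotv0l.
by rewrite !big_cons dotvDr IH.
Qed.

Lemma dotvv_ge0 u : 0 <= dotv u u.
Proof. by apply: sumr_ge0 => i _; rewrite -expr2 sqr_ge0. Qed.

Lemma sqr_enorm u : enorm u ^+ 2 = dotv u u.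
Proof. by rewrite /enorm sqr_sqrtr ?dotvv_ge0. Qed.

Lemma enorm_ge0 u : 0 <= enorm u.
Proof. exact: sqrtr_ge0. Qed.

Lemma dotvv_eq0 u : (dotv u u == 0) = (u == 0).
Proof.
apply/idP/eqP => [|->]; last by rewrite dotv0l.
rewrite psumr_eq0 => [/allP u0|i _]; last by rewrite -expr2 sqr_ge0.
apply/rowP => i; rewrite mxE; have /(_ (mem_index_enum i)) := u0 i.
by rewrite mulf_eq0 orbb => /eqP.
Qed.

Lemma enorm0 : enorm (0 : 'rV[R]_n) = 0.
Proof. by rewrite /enorm dotv0l sqrtr0. Qed.

Lemma enormZ a u : enorm (a *: u) = `|a| * enorm u.
Proof.
by rewrite /enorm !dotv_lin mulrA -expr2 sqrtrM ?sqr_ge0// sqrtr_sqr.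
Qed.

Lemma enormN u : enorm (- u) = enorm u.
Proof. by rewrite -scaleN1r enormZ normrN1 mul1r. Qed.

Lemma sqr_dotv_le u v : dotv u v ^+ 2 <= dotv u u * dotv v v.
Proof.
have [->|v0] := eqVneq v 0; first by rewrite dotvC !dotv0l expr0n mulr0.
have vv : 0 < dotv v v by rewrite lt_neqAle dotvv_ge0 eq_sym dotvv_eq0 v0.
have := dotvv_ge0 (dotv v v *: u - dotv u v *: v).
rewrite !dotv_lin (dotvC v u).
rewrite (_ : _ + _ = dotv v v * (dotv u u * dotv v v - dotv u v ^+ 2)); last by ring.
by rewrite pmulr_rge0// subr_ge0.
Qed.

Lemma dotv_le u v : `|dotv u v| <= enorm u * enorm v.
Proof.
rewrite -ler_sqr ?nnegrE ?mulr_ge0 ?enorm_ge0//.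
by rewrite real_normK ?num_real// exprMn !sqr_enorm sqr_dotv_le.
Qed.

Lemma dotv_ler u v : dotv u v <= enorm u * enorm v.
Proof. exact: le_trans (ler_norm _) (dotv_le u v). Qed.

Lemma ler_enormD u v : enorm (u + v) <= enorm u + enorm v.
Proof.
rewrite -ler_sqr ?nnegrE ?addr_ge0 ?enorm_ge0//.
rewrite sqrrD !sqr_enorm !dotv_lin (dotvC v u).
by have := dotv_ler u v; lra.
Qed.

Lemma ler_enorm_sum (I : Type) (r : seq I) (F : I -> 'rV[R]_n) :
  enorm (\sum_(i <- r) F i) <= \sum_(i <- r) enorm (F i).
Proof.
elim: r => [|i r IH]; first by rewrite !big_nil enorm0.
by rewrite !big_cons (le_trans (ler_enormD _ _))// lerD2l.
Qed.

Lemma sqr_enormD_le u v :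
  enorm (u + v) ^+ 2 <= 2 * enorm u ^+ 2 + 2 * enorm v ^+ 2.
Proof.
have := dotvv_ge0 (u - v); rewrite !sqr_enorm !dotv_lin (dotvC v u); lra.
Qed.

Lemma dotv_young (c : R) u v : 0 < c ->
  `|dotv u v| <= c / 2 * enorm u ^+ 2 + (2 * c)^-1 * enorm v ^+ 2.
Proof.
move=> c0; apply: le_trans (dotv_le u v) _.
rewrite -subr_ge0 (_ : _ - _ = c / 2 * (enorm u - c^-1 * enorm v) ^+ 2).
  by rewrite mulr_ge0 ?sqr_ge0// divr_ge0// ltW.
by field; rewrite gt_eqF.
Qed.

Lemma dotv_delta u i : dotv u (delta_mx 0 i) = u 0 i.
Proof.
rewrite /dotv (bigD1 i)//= big1 => [|j ji]; rewrite mxE !eqxx ?mulr1 ?addr0//.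
by rewrite (negbTE ji) mulr0.
Qed.

End Euclidean.

Section SpectralNorm.
Context {R : realType} {n p : nat}.
Implicit Types (M : 'M[R]_(n, p)).

(** The squared Frobenius norm [s] bounds the squares by Cauchy-Schwarz on each column, and [1 + s]
    then bounds the norms without a square root. *)
Lemma has_sup_spectral_norm M :
  has_sup [set enorm (v *m M) | v in [set v : 'rV[R]_n | enorm v <= 1]].
Proof.
split; first by exists (enorm (0 *m M)); exists 0 => //=; rewrite enorm0 ler01.
pose s : R := \sum_j dotv (\row_i M i j) (\row_i M i j).
exists (1 + s) => _ [v /= v1 <-].
have s0 : 0 <= s by apply: sumr_ge0 => j _; exact: dotvv_ge0.
suff : enorm (v *m M) ^+ 2 <= s.
  by have := enorm_ge0 (v *m M); nra.
rewrite sqr_enorm; apply: ler_sum => j _.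
have -> : (v *m M) 0 j = dotv v (\row_i M i j).
  by rewrite mxE; apply: eq_bigr => i _; rewrite mxE.
rewrite -expr2 (le_trans (sqr_dotv_le _ _))// ler_piMl ?dotvv_ge0//.
by rewrite -sqr_enorm expr_le1// enorm_ge0.
Qed.

Lemma spectral_norm_ge0 M : 0 <= spectral_norm M.
Proof.
have [_ ub] := has_sup_spectral_norm M.
apply: ub_le_sup => //; exists 0; first by rewrite /= enorm0 ler01.
by rewrite mul0mx enorm0.
Qed.

Lemma enorm_mulmx_le M v : enorm (v *m M) <= spectral_norm M * enorm v.
Proof.
have [->|v0] := eqVneq v 0; first by rewrite mul0mx !enorm0 mulr0.
have vp : 0 < enorm v.
  by rewrite sqrtr_gt0 lt_neqAle dotvv_ge0 eq_sym dotvv_eq0 v0.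
have [_ ub] := has_sup_spectral_norm M.
rewrite -ler_pdivrMr//; apply: ub_le_sup => //.
exists ((enorm v)^-1 *: v) => [/=|].
  by rewrite enormZ ger0_norm ?invr_ge0 ?enorm_ge0// mulVf// gt_eqF.
by rewrite -scalemxAl enormZ ger0_norm ?invr_ge0 ?enorm_ge0// mulrC.
Qed.

(** Duality: for [a = w *m M^T] one has [|a|^2 = <a *m M, w>], so the bound for [M] passes to its
    transpose after division by [|a|]. *)
Lemma enorm_mulmxT_le M (w : 'rV[R]_p) :
  enorm (w *m M^T) <= spectral_norm M * enorm w.
Proof.
set a := w *m M^T.
have [->|a0] := eqVneq a 0.
  by rewrite enorm0 mulr_ge0 ?enorm_ge0 ?spectral_norm_ge0.
have ap : 0 < enorm a.
  by rewrite sqrtr_gt0 lt_neqAle dotvv_ge0 eq_sym dotvv_eq0 a0.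
rewrite -(ler_pM2l ap) -expr2 sqr_enorm.
have -> : dotv a a = dotv (a *m M) w.
  by rewrite [RHS]dotvC !dotvE [in RHS]trmx_mul mulmxA.
rewrite (le_trans (dotv_ler _ _))// mulrA ler_wpM2r ?enorm_ge0//.
by rewrite (mulrC (enorm a)) enorm_mulmx_le.
Qed.

End SpectralNorm.

(** * Calculus along lines *)

Section DirectionalDerivative.
Context {R : realType} {n : nat}.
Implicit Types (x v : 'rV[R]_n).

Lemma is_derive_line (W : normedModType R) (f : 'rV[R]_n -> W) x v (t : R) :
  derivable f (x + t *: v) v ->
  is_derive t (1 : R) (fun s : R => f (x + s *: v)) ('D_v f (x + t *: v)).
Proof.
have E : (fun h : R => h^-1 *: (((fun s : R => f (x + s *: v)) \o shift t) (h *: (1 : R))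
             - f (x + t *: v)))
    = (fun h : R => h^-1 *: ((f \o shift (x + t *: v)) (h *: v) - f (x + t *: v))).
  apply/funext => h /=; congr (_ *: (f _ - _)).
  by rewrite [h *: 1]mulr1 scalerDl addrCA.
by move=> df; apply: DeriveDef; rewrite /derivable /derive E.
Qed.

Lemma line_MVT (f : 'rV[R]_n -> R) x v :
  (forall u, derivable f u v) ->
  exists2 t, 0 <= t <= 1 & f (x + v) - f x = 'D_v f (x + t *: v).
Proof.
move=> df.
have dg (t : R) := is_derive_line (df (x + t *: v)).
have [|t t01] := @MVT_segment R (fun s => f (x + s *: v))
    (fun t => 'D_v f (x + t *: v)) 0 1 ler01 (fun t _ => dg t).
  apply: continuous_subspaceT => t; apply: differentiable_continuous.
  by apply/derivable1_diffP; case: (dg t).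
by rewrite scale1r scale0r addr0 subr0 mulr1 => E; exists t; rewrite -?in_itv.
Qed.

(** Convexity and minimality control the difference quotient only for [t > 0], so the two-sided
    limit is restricted to the right. *)
Lemma derive_le (f : 'rV[R]_n -> R) x v (K : R) : derivable f x v ->
  (forall t, 0 < t < 1 -> f (x + t *: v) - f x <= t * K) -> 'D_v f x <= K.
Proof.
move=> df fK; have /cvg_dnbhs_at_right cvq := df.
rewrite /derive -(cvg_lim (@norm_hausdorff _ _) cvq); apply: limr_le.
  by apply/cvg_ex; eexists; exact: cvq.
near=> t; have t0 : 0 < t by [].
rewrite /GRing.scale/= ler_pdivrMl// (addrC (t *: v)) fK// t0/=.
by near: t; exact: nbhs_right_lt.
Unshelve. all: by end_near. Qed.

Lemma derive_ge (f : 'rV[R]_n -> R) x v (K : R) : derivable f x v ->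
  (forall t, 0 < t < 1 -> t * K <= f (x + t *: v) - f x) -> K <= 'D_v f x.
Proof.
move=> df fK; rewrite -lerN2 -deriveN//; apply: derive_le; first exact: derivableN.
move=> t /fK; rewrite -[(- f) _]/(- f _) -[(- f) x]/(- f x); lra.
Qed.

Lemma derive_dotv (f : 'rV[R]_n -> R) x v : differentiable f x ->
  'D_v f x = dotv (grad f x) v.
Proof.
move=> df; rewrite deriveE// [X in 'd f x X](row_sum_delta v) linear_sum.
by apply: eq_bigr => i _; rewrite linearZ /= mxE deriveE// mulrC.
Qed.

Lemma gradP (f : 'rV[R]_n -> R) x g :
  (forall v, 'D_v f x = dotv g v) -> grad f x = g.
Proof. by move=> fg; apply/rowP => i; rewrite mxE fg dotv_delta. Qed.

Lemma derive_dotv_map p (G : 'rV[R]_n -> 'rV[R]_p) (w : 'rV[R]_p) x v :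
  derivable G x v ->
  is_derive x v (fun u => dotv w (G u)) (dotv w ('D_v G x)).
Proof.
move=> dG; have /derivable_mxP dGi := dG.
have -> : (fun u => dotv w (G u)) = \sum_(i < p) (w 0 i *: (fun u => G u 0 i)).
  by apply/funext => u; rewrite fct_sumE.
rewrite derive_mx// /dotv.
apply: is_derive_eq; first by apply: is_derive_sum => i; apply: is_deriveZ; apply: derivableP.
by apply: eq_bigr => i _; rewrite mxE.
Qed.

End DirectionalDerivative.

(** * Consequences of Lipschitz gradients, convexity and bounded Jacobians *)

Section Smoothness.
Context {R : realType} {n : nat}.
Implicit Types (f : 'rV[R]_n -> R) (x y : 'rV[R]_n).

(** The mean value theorem replaces integration: once the quadratic [k] is subtracted, the
    derivative along the segment is nonpositive at every [t], so the sharp constant [l / 2]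
    survives. *)
Lemma descent_lemma f (l : R) x y : (forall u, differentiable f u) ->
  smooth_fun l f ->
  f y <= f x + dotv (grad f x) (y - x) + l / 2 * enorm (y - x) ^+ 2.
Proof.
move=> df fl; set v := y - x.
pose g (t : R) := f (x + t *: v).
pose k (t : R) := t * dotv (grad f x) v + l / 2 * enorm v ^+ 2 * t ^+ 2.
have dg (t : R) : is_derive t (1 : R) g (dotv (grad f (x + t *: v)) v).
  by rewrite -derive_dotv//; apply: is_derive_line; exact: diff_derivable.
have dk (t : R) : is_derive t (1 : R) (g \- k)
    (dotv (grad f (x + t *: v)) v
     - (dotv (grad f x) v + l * enorm v ^+ 2 * t)).
  have -> : k = (dotv (grad f x) v) *: id
      + (l / 2 * enorm v ^+ 2) *: ((@id R) ^+ 2).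
    by apply/funext => s; rewrite /k /GRing.scale/= /GRing.add/= /GRing.exp/= mulrC.
  apply: (is_derive_eq (is_deriveB (dg t)
    (is_deriveD (is_deriveZ (dotv (grad f x) v) (is_derive_id t (1 : R)))
                (is_deriveZ (l / 2 * enorm v ^+ 2)
                   (is_deriveX 2 (is_derive_id t (1 : R))))))).
  by rewrite /GRing.scale/= expr1 mulr1; field.
have [|t /andP[]] := @MVT_segment R (g \- k) _ 0 1 ler01 (fun t _ => dk t).
- apply: continuous_subspaceT => t; apply: differentiable_continuous.
  by apply/derivable1_diffP; case: (dk t).
- rewrite bnd_simp => t0 _ /=; rewrite /g /k scale1r scale0r addr0.
  have -> : x + v = y by rewrite /v addrC subrK.
  have /= := dotv_ler (grad f (x + t *: v) - grad f x) v.
  have := fl (x + t *: v) x.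
  rewrite (addrC x) addrK enormZ ger0_norm// dotvDl dotvNl.
  have := enorm_ge0 v; rewrite expr2; nra.
Qed.

Lemma convex_grad_le f x y : differentiable f x ->
  convex_function [set: convex_lmodType 'rV[R]_n] f ->
  f x + dotv (grad f x) (y - x) <= f y.
Proof.
move=> df cf; rewrite addrC -lerBrDr -derive_dotv//.
apply: derive_le => [|t /andP[t0 t1]]; first exact: diff_derivable.
have := cf (Itv01 (ltW t0) (ltW t1)) y x.
rewrite !inE => /(_ I I); rewrite {1}/conv/= /unstable.onem.
rewrite [X in _ <= X -> _](_ : _ = t * f y + (1 - t) * f x)//.
have -> : t *: y + (1 - t) *: x = x + t *: (y - x).
  by rewrite scalerBl scale1r scalerBr addrCA.
lra.
Qed.

(** The mean value theorem is false for vector-valued maps; it is applied to the scalar function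
    [<w, G>] with [w] the increment itself, which gives [|w|^2 <= |w| * b * |v|]. *)
Lemma jacobian_lipschitz p (G : 'rV[R]_n -> 'rV[R]_p) (b : R) x y :
  (forall u, differentiable G u) -> bounded_jacobian b G ->
  enorm (G y - G x) <= b * enorm (y - x).
Proof.
move=> dG Gb; set w := G y - G x; set v := y - x.
have dP u := derive_dotv_map w (@diff_derivable _ _ _ _ _ v (dG u)).
have [t _] := @line_MVT R n (fun u => dotv w (G u)) x v
  (fun u => @ex_derive _ _ _ _ _ _ _ (dP u)).
have -> : x + v = y by rewrite /v addrC subrK.
rewrite (@derive_val _ _ _ _ _ _ _ (dP _)) deriveEjacobian//.
rewrite -dotvNr -dotvDr -/w -sqr_enorm => Ew.
have [w0|w0] := eqVneq (enorm w) 0.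
  by rewrite w0 mulr_ge0 ?enorm_ge0// (le_trans (spectral_norm_ge0 _) (Gb x)).
have wp : 0 < enorm w by rewrite lt_neqAle eq_sym w0 enorm_ge0.
rewrite -(ler_pM2l wp) -expr2 Ew (le_trans (dotv_ler _ _))// ler_pM2l//.
rewrite (le_trans (enorm_mulmx_le _ _))// ler_wpM2r ?enorm_ge0//.

Qed.

End Smoothness.

(** * Averages and compositions *)

Section Composition.
Context {R : realType}.

Lemma grad_comp n p (F : 'rV[R]_p -> R) (G : 'rV[R]_n -> 'rV[R]_p) x :
  differentiable G x -> differentiable F (G x) ->
  grad (F \o G) x = grad F (G x) *m ('J G x)^T.
Proof.
move=> dG dF; apply: gradP => v.
rewrite deriveE; last exact: differentiable_comp.
rewrite diff_comp//= -deriveE// derive_dotv// -deriveE// deriveEjacobian//.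
by rewrite !dotvE trmx_mul mulmxA.
Qed.

Lemma enorm_avg_le n p (X : 'I_n -> 'rV[R]_p) (b : R) : (0 < n)%N ->
  (forall i, enorm (X i) <= b) -> enorm (n%:R^-1 *: \sum_i X i) <= b.
Proof.
move=> n0 Xb; rewrite enormZ ger0_norm ?invr_ge0//.
rewrite ler_pdivrMl ?ltr0n// (le_trans (ler_enorm_sum _ _))//.
by rewrite (le_trans (ler_sum _ (fun i _ => Xb i)))// sumr_const card_ord mulr_natl.
Qed.

Lemma avg_mapE n2 N1 N2 (Gj : 'I_n2 -> 'rV[R]_N2 -> 'rV[R]_N1) :
  avg_map Gj = n2%:R^-1 *: \sum_j Gj j.
Proof. by apply/funext => x; rewrite /avg_map -[RHS]/(_ *: _ x) fct_sumE. Qed.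

Lemma avg_funE n1 N1 (Fi : 'I_n1 -> 'rV[R]_N1 -> R) :
  avg_fun Fi = n1%:R^-1 *: \sum_j Fi j.
Proof. by apply/funext => x; rewrite /avg_fun -[RHS]/(_ *: _ x) fct_sumE. Qed.

Lemma differentiable_avg_map n2 N1 N2 (Gj : 'I_n2 -> 'rV[R]_N2 -> 'rV[R]_N1) x :
  (forall j, differentiable (Gj j) x) -> differentiable (avg_map Gj) x.
Proof.
by move=> dG; rewrite avg_mapE; apply: differentiableZ; exact: differentiable_sum.
Qed.

Lemma differentiable_avg_fun n1 N1 (Fi : 'I_n1 -> 'rV[R]_N1 -> R) u :
  (forall i, differentiable (Fi i) u) -> differentiable (avg_fun Fi) u.
Proof.
by move=> dF; rewrite avg_funE; apply: differentiableZ; exact: differentiable_sum.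
Qed.

Lemma jacobian_avg n2 N1 N2 (Gj : 'I_n2 -> 'rV[R]_N2 -> 'rV[R]_N1) x :
  (forall j, differentiable (Gj j) x) ->
  'J (avg_map Gj) x = n2%:R^-1 *: \sum_j 'J (Gj j) x.
Proof.
move=> dG; apply/row_matrixP => i; rewrite !rowE -deriveEjacobian; last first.
  exact: differentiable_avg_map.
rewrite avg_mapE deriveZ; last by apply: derivable_sum => j; exact: diff_derivable.
rewrite derive_sum => [|j]; last exact: diff_derivable.
rewrite -scalemxAr mulmx_sumr; congr (_ *: _).
by apply: eq_bigr => j _; rewrite deriveEjacobian.
Qed.

Lemma grad_avg n1 N1 (Fi : 'I_n1 -> 'rV[R]_N1 -> R) u :
  (forall i, differentiable (Fi i) u) ->
  grad (avg_fun Fi) u = n1%:R^-1 *: \sum_i grad (Fi i) u.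
Proof.
move=> dF; apply: gradP => v.
rewrite avg_funE deriveZ; last by apply: derivable_sum => j; exact: diff_derivable.
rewrite derive_sum => [|j]; last exact: diff_derivable.
rewrite dotvZl dotvC dotv_sumr; congr (_ * _).
by apply: eq_bigr => j _; rewrite derive_dotv// dotvC.
Qed.

End Composition.

(** * Gradient and smoothness of the composition of averages *)

Section SmoothPart.
Context {R : realType} {n1 n2 N1 N2 : nat}.
Variables (Fi : 'I_n1 -> 'rV[R]_N1 -> R) (Gj : 'I_n2 -> 'rV[R]_N2 -> 'rV[R]_N1).
Hypotheses (n1_gt0 : (0 < n1)%N) (n2_gt0 : (0 < n2)%N).
Hypothesis dF : forall i u, differentiable (Fi i) u.
Hypothesis dG : forall j x, differentiable (Gj j) x.

Lemma differentiable_smooth_part x : differentiable (smooth_part Fi Gj) x.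
Proof.
by apply: differentiable_comp; [exact: differentiable_avg_map|
                                exact: differentiable_avg_fun].
Qed.

Lemma grad_smooth_part x : grad (smooth_part Fi Gj) x
  = grad (avg_fun Fi) (avg_map Gj x) *m ('J (avg_map Gj) x)^T.
Proof.
by apply: grad_comp; [exact: differentiable_avg_map|exact: differentiable_avg_fun].
Qed.

(** By bilinearity of the matrix product the gradient of the composition is the double average of
    the vectors [T i j], and averaging preserves a Lipschitz constant. *)
Lemma smooth_fun_smooth_part (L : R) :
  (forall i j x y,
     enorm (grad (Fi i) (avg_map Gj x) *m ('J (Gj j) x)^T
            - grad (Fi i) (avg_map Gj y) *m ('J (Gj j) y)^T)
       <= L * enorm (x - y)) ->
  smooth_fun L (smooth_part Fi Gj).
Proof.
move=> FGL x y; rewrite !grad_smooth_part !grad_avg// !jacobian_avg//.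
pose T i j z := grad (Fi i) (avg_map Gj z) *m ('J (Gj j) z)^T.
have E z : (n1%:R^-1 *: \sum_i grad (Fi i) (avg_map Gj z))
      *m (n2%:R^-1 *: \sum_j 'J (Gj j) z)^T
    = n1%:R^-1 *: \sum_i (n2%:R^-1 *: \sum_j T i j z).
  rewrite -scalemxAl mulmx_suml; congr (_ *: _); apply: eq_bigr => i _.
  by rewrite linearZ/= -scalemxAr linear_sum/= mulmx_sumr.
rewrite !E -scalerBr -sumrB; apply: enorm_avg_le => // i.
rewrite -scalerBr -sumrB; apply: enorm_avg_le => // j; exact: FGL.
Qed.

Lemma bounded_grad_avg (b : R) :
  (forall i, bounded_grad b (Fi i)) -> bounded_grad b (avg_fun Fi).
Proof. by move=> Fb u; rewrite grad_avg//; apply: enorm_avg_le => // i; exact: Fb. Qed.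

Lemma smooth_fun_avg (l : R) :
  (forall i, smooth_fun l (Fi i)) -> smooth_fun l (avg_fun Fi).
Proof.
move=> Fl u v; rewrite !grad_avg// -scalerBr -sumrB.
by apply: enorm_avg_le => // i; exact: Fl.
Qed.

Lemma enorm_mul_jacobian_avgT (b : R) x (w : 'rV[R]_N1) :
  (forall j, bounded_jacobian b (Gj j)) ->
  enorm (w *m ('J (avg_map Gj) x)^T) <= b * enorm w.
Proof.
move=> Gb; rewrite jacobian_avg// linearZ/= -scalemxAr linear_sum/= mulmx_sumr.
apply: enorm_avg_le => // j; rewrite (le_trans (enorm_mulmxT_le _ _))//.
by rewrite ler_wpM2r ?enorm_ge0//; exact: Gb.
Qed.

End SmoothPart.

(** * Existence and optimality of prox steps *)

Section LowerSemicontinuity.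
Context {R : realType} {T : topologicalType}.
Local Open Scope ereal_scope.

(** A slack [e] is taken from the strict inequality for [h], and [q] may vary by at most [e] near
    [x]. Where [h x] is infinite any positive slack will do. *)
Lemma lower_semicontinuous_addEFin (q : T -> R) (h : T -> \bar R) :
  continuous q -> (forall x, -oo < h x) -> lower_semicontinuous h ->
  lower_semicontinuous (fun x => (q x)%:E + h x).
Proof.
move=> cq hNy lh x a ax.
have [e e0 ae] : exists2 e : R, (0 < e)%R & (a - q x + e)%:E < h x.
  case: (h x) (hNy x) ax => [b| |]// _.
    rewrite -EFinD lte_fin => ab; exists ((b - (a - q x)) / 2)%R.
      by lra.
    by rewrite lte_fin; lra.
  by move=> _; exists 1%R => //; rewrite ltry.
have [V Vx hV] := lh x _ ae.
exists (V `&` [set y | `|q x - q y| < e]%R).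
  apply: filterI => //; have /cvgrPdist_lt/(_ e e0) := cq x; exact.
move=> y [/hV + /=]; case: (h y) (hNy y) => [b| |]// _.
  rewrite !lte_fin ltr_norml => ? /andP[? ?]; lra.
by rewrite addey ?ltry.
Qed.

(** Without a minimizer, the open sets of points strictly above [phi q], for [q] in [K], cover [K].
    In a finite subcover the index with the least value is covered by none of them. Finiteness of
    [phi] on [K] makes the thresholds real, hence the sets open. *)
Lemma compact_min_lower_semicontinuous (T' : ptopologicalType)
    (phi : T' -> \bar R) (K : set T') :
  K !=set0 -> compact K -> (forall x, K x -> phi x \is a fin_num) ->
  lower_semicontinuous phi -> exists2 x, K x & forall y, K y -> phi x <= phi y.
Proof.
move=> [x0 Kx0] + fphi lphi; rewrite compact_cover => cK.
apply: contrapT => nomin.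
have [||D' D'K KD'] := cK T' K (fun q => [set u | phi q < phi u]).
- move=> q /fphi/fineK <-; by move/lower_semicontinuousP: lphi; exact.
- move=> u Ku; apply: contrapT => nu; apply: nomin; exists u => // y Ky.
  by rewrite leNgt; apply/negP => yu; apply: nu; exists y.
have seq_min (s : seq T') : s != [::] ->
    exists2 x, x \in s & forall y, y \in s -> phi x <= phi y.
  elim: s => // x s IH _; have [->|/IH[z zs zmin]] := eqVneq s [::].
    by exists x; rewrite ?mem_head// => y; rewrite inE => /eqP ->.
  have [xz|/ltW zx] := leP (phi x) (phi z).
    exists x; rewrite ?mem_head// => y; rewrite inE => /orP[/eqP->//|/zmin].
    exact: le_trans.
  exists z; rewrite ?inE ?zs ?orbT// => y; rewrite inE => /orP[/eqP->//|].
  exact: zmin.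
have [q0 /= q0D _] := KD' _ Kx0.
have [|q qD qmin] := seq_min (enum_fset D').
  by apply/eqP => D0; move: q0D; rewrite /= -[_ \in _]/(q0 \in enum_fset D') D0.
have /KD'[r /= rD] : K q by exact: set_mem (D'K _ qD).
by rewrite ltNge qmin.
Qed.

End LowerSemicontinuity.

Section Quadratic.
Context {R : realType} {n : nat}.
Variables (d z : 'rV[R]_n) (c : R).

Let q u := dotv d u + c * enorm (u - z) ^+ 2.

Lemma is_derive_coord (x v : 'rV[R]_n) i :
  is_derive x v (fun u : 'rV[R]_n => u 0 i : R) (v 0 i).
Proof.
have /derivable_mxP/(_ 0 i) dx : derivable (@id 'rV[R]_n) x v by exact: derivable_id.
apply: DeriveDef => //.
have := derive_id x v; rewrite derive_mx// => /matrixP/(_ 0 i).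
by rewrite mxE.
Qed.

Let qE : q = \sum_i (d 0 i *: (fun u : 'rV[R]_n => u 0 i : R)
   + c *: ((fun u : 'rV[R]_n => u 0 i : R) - cst (z 0 i)) ^+ 2).
Proof.
apply/funext => u; rewrite fct_sumE /q sqr_enorm /dotv mulr_sumr -big_split/=.
apply: eq_bigr => i _.
by rewrite -[RHS]/(d 0 i * u 0 i + c * ((u 0 i - z 0 i) * (u 0 i - z 0 i))) !mxE.
Qed.

Lemma differentiable_quadratic x : differentiable q x.
Proof.
rewrite qE; apply: differentiable_sum => i.
apply: differentiableD; apply: differentiableZ; first exact: differentiable_coord.
apply: differentiableX; apply: differentiableB; first exact: differentiable_coord.
exact: differentiable_cst.
Qed.

Lemma grad_quadratic x : grad q x = d + (2 * c) *: (x - z).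
Proof.
apply: gradP => v; rewrite qE.
have dc := is_derive_coord x v.
have dq i := is_deriveD (is_deriveZ (d 0 i) (dc i))
  (is_deriveZ c (is_deriveX 2 (is_deriveB (dc i) (is_derive_cst (z 0 i) x v)))).
rewrite derive_sum => [|i]; last by case: (dq i).
apply: eq_bigr => i _; rewrite (@derive_val _ _ _ _ _ _ _ (dq i)) !mxE subr0.
rewrite -[LHS]/(d 0 i * v 0 i + c * (2 * (x 0 i - z 0 i) * v 0 i)).
by ring.
Qed.

End Quadratic.

Section Prox.
Context {R : realType} {n : nat}.
Variable h : 'rV[R]_n -> \bar R.
Hypotheses (h_proper : proper_fun h) (h_lsc : lower_semicontinuous h)
  (h_convex : ext_convex h).

Lemma proper_fineK x : (h x < +oo)%E -> (fine (h x))%:E = h x.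
Proof. by move=> hx; apply: fineK; rewrite fin_numE gt_eqF ?lt_eqF//; case: h_proper. Qed.

(** Along [x + t *: (y - x)], minimality and the convexity of [h] bound the increment of [q] below
    by [t * (h x - h y)]; the derivative at [t = 0] inherits the bound. *)
Lemma minimizer_subgradient (q : 'rV[R]_n -> R) x : differentiable q x ->
  (h x < +oo)%E -> minimizer (fun u => ((q u)%:E + h u)%E) x ->
  subgradient h x (- grad q x).
Proof.
move=> dq hx xmin y; have [hyoo|] := leP +oo%E (h y).
  by rewrite (le_trans _ hyoo)// leey.
move=> hy; have hxE := proper_fineK hx; have hyE := proper_fineK hy.
rewrite -hxE -hyE -EFinD lee_fin dotvNl -derive_dotv// lerBlDl -lerBlDr.
apply: derive_ge => [|t /andP[t0 t1]]; first exact: diff_derivable.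
have t01 : 0 <= t <= 1 by rewrite !ltW.
have := h_convex y x t01.
have -> : t *: y + (1 - t) *: x = x + t *: (y - x).
  by rewrite scalerBl scale1r scalerBr addrCA.
move=> hxy; have := xmin (x + t *: (y - x)).
have : (h (x + t *: (y - x)) < +oo)%E.
  by rewrite (le_lt_trans hxy)// -hxE -hyE -!EFinM -EFinD ltry.
move: hxy => /[swap] /proper_fineK <-.
rewrite -hxE -hyE -!EFinM -!EFinD !lee_fin/=; lra.
Qed.

(** One subgradient of [h] gives an affine minorant, so the quadratic makes the objective coercive;
    its sublevel set at [x0] is then compact. *)
Lemma quadratic_argmin (d z : 'rV[R]_n) (c : R) (x0 g : 'rV[R]_n) :
  0 < c -> (h x0 < +oo)%E -> subgradient h x0 g ->
  minimizer (fun u => ((dotv d u + c * enorm (u - z) ^+ 2)%:E + h u)%E)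
    (argmin (fun u => ((dotv d u + c * enorm (u - z) ^+ 2)%:E + h u)%E)).
Proof.
move=> c0 hx0 hg; set q := fun u => dotv d u + c * enorm (u - z) ^+ 2.
pose phi u := ((q u)%:E + h u)%E.
apply: (@xgetPex _ 0 [set x | minimizer phi x]).
have hNy : forall u, (-oo < h u)%E by case: h_proper.
have hx0E := proper_fineK hx0; set a := fine _ in hx0E.
have lphi : lower_semicontinuous phi.
  apply: lower_semicontinuous_addEFin => // u.
  exact/differentiable_continuous/differentiable_quadratic.
have phi0 : phi x0 = (q x0 + a)%:E by rewrite /phi -hx0E.
pose K := [set u | (phi u <= phi x0)%E].
pose b := dotv d z + a + dotv g (z - x0).
pose s := enorm d + enorm g.
(* With [w = u - z], the objective is at least [b - s * |w| + c * |w|^2]. Beyond the second bound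
   [c * |w| - s] exceeds [|q x0 + a - b| + 1], and [|w| > 1] lets this survive the multiplication by
   [|w|]. *)
pose rho := Num.max 1 ((s + `|q x0 + a - b| + 1) / c).
have Krho u : K u -> enorm (u - z) <= rho.
  move=> Ku; rewrite leNgt; apply/negP; rewrite /rho gt_max => /andP[r1].
  rewrite ltr_pdivrMr// => rc.
  move: Ku; rewrite /K/= leNgt => /negP; apply; rewrite phi0 /phi.
  apply: lt_le_trans (leeD2l _ (hg u)); rewrite -hx0E -!EFinD lte_fin.
  have [w uE] : exists w, u = z + w by exists (u - z); rewrite addrC subrK.
  have uzw : u - z = w by rewrite uE addrC addKr.
  have quE : q u = dotv d z + dotv d w + c * enorm w ^+ 2.
    by rewrite /q uzw uE dotvDr.
  rewrite uzw in r1 rc; rewrite quE uE -addrA !dotvDr.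
  have := dotv_le d w; have := dotv_le g w.
  rewrite !ler_norml => /andP[H1 _] /andP[H2 _].
  have bE : b = dotv d z + a + (dotv g z + dotv g (- x0)) by rewrite /b dotvDr.
  have := ler_norm (q x0 + a - b); set D := `|_| in rc *.
  rewrite bE [q x0]/q.
  have D0 : 0 <= D by exact: normr_ge0.
  rewrite /s in rc; set e := enorm w in r1 rc H1 H2 *.
  have := ler_wpM2l (le_trans ler01 (ltW r1)) (ltW rc).
  have : (D + 1) <= e * (D + 1) by rewrite ler_peMl ?ltW//; lra.
  nra.
have Kx0 : K x0 by rewrite /K/=.
have [| |u Ku| |x Kx xmin] := @compact_min_lower_semicontinuous R _ phi K; [by exists x0| | |by []|].
- apply: bounded_closed_compact; last first.
    rewrite (_ : K = ~` [set u | (phi x0 < phi u)%E]); last first.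
      by apply/seteqP; split => u; rewrite /K/= leNgt => /negP.
    by apply: open_closedC; rewrite phi0; move/lower_semicontinuousP: lphi; exact.
  exists (rho + enorm z); split; first exact: num_real.
  move=> M rM u /Krho ur; apply: (le_trans _ (ltW rM)).
  have ue : enorm u <= rho + enorm z.
    by rewrite -(subrK z u) (le_trans (ler_enormD _ _))// lerD2r.
  (* Boundedness refers to the sup norm, which the Euclidean norm dominates coordinate by
     coordinate. *)
  apply: (le_trans _ ue); rewrite [leLHS]/Num.norm/= mx_normrE.
  apply/bigmax_leP; split => [|[i j] _ /=]; first exact: enorm_ge0.
  rewrite ord1 -dotv_delta (le_trans (dotv_le _ _))//.
  by rewrite {2}/enorm dotv_delta mxE !eqxx sqrtr1 mulr1.
- rewrite fin_numE; apply/andP; split.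
    by rewrite /phi; case: (h u) (hNy u).
  by rewrite lt_eqF// (le_lt_trans Ku)// phi0 ltry.
exists x => u; have [/xmin//|] := leP (phi u) (phi x0).
by move=> /ltW; exact: le_trans.
Qed.

(** Strong convexity is used at the subgradient [- (d + (2 * c) *: (x - z))] that optimality
    supplies; expanding the square around [x] adds the curvature [c] to [mu / 2]. *)
Lemma prox_le (mu : R) (d z x u : 'rV[R]_n) (c : R) :
  strongly_convex mu h -> (h u < +oo)%E ->
  minimizer (fun u => ((dotv d u + c * enorm (u - z) ^+ 2)%:E + h u)%E) x ->
  (h x < +oo)%E /\
  dotv d x + c * enorm (x - z) ^+ 2 + fine (h x)
    + (c + mu / 2) * enorm (u - x) ^+ 2
  <= dotv d u + c * enorm (u - z) ^+ 2 + fine (h u).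
Proof.
move=> hmu hu xmin.
have hx : (h x < +oo)%E.
  have := xmin u; rewrite -(proper_fineK hu) -EFinD.
  by case: (h x) => [r| |]// _; exact: ltry.
split=> //; have dq := differentiable_quadratic d z c x.
have := hmu x u _ (minimizer_subgradient dq hx xmin).
rewrite -(proper_fineK hu) -(proper_fineK hx) -EFinD lee_fin grad_quadratic.
rewrite !sqr_enorm !dotv_lin (dotvC u x) (dotvC z x) (dotvC z u); lra.
Qed.

End Prox.

(** * Uniform means over samples *)

Section UniformMean.
Context {R : realType}.
Implicit Types T U : finType.

Definition umean T (X : T -> R) : R := #|T|%:R^-1 * \sum_t X t.

Lemma umean_le T (X Y : T -> R) : (forall t, X t <= Y t) -> umean X <= umean Y.
Proof. by move=> XY; rewrite ler_wpM2l ?invr_ge0//; exact: ler_sum. Qed.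

Lemma eq_umean T (X Y : T -> R) : X =1 Y -> umean X = umean Y.
Proof. by move=> XY; rewrite /umean (eq_bigr Y). Qed.

Lemma umeanD T (X Y : T -> R) :
  umean (fun t => X t + Y t) = umean X + umean Y.
Proof. by rewrite /umean big_split mulrDr. Qed.

Lemma umeanZ T (X : T -> R) (c : R) : umean (fun t => c * X t) = c * umean X.
Proof. by rewrite /umean -mulr_sumr mulrCA. Qed.

Lemma umean_cst T (c : R) : (0 < #|T|)%N -> umean (fun _ : T => c) = c.
Proof.
by move=> T0; rewrite /umean sumr_const -(mulr_natl c) mulKf// pnatr_eq0 -lt0n.
Qed.

Lemma umean_pair T U (X : T * U -> R) :
  umean X = umean (fun t => umean (fun u => X (t, u))).
Proof.
rewrite /umean card_prod natrM invfM -mulrA; congr (_ * _).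
rewrite -mulr_sumr; congr (_ * _).
by rewrite pair_bigA; apply: eq_bigr => -[].
Qed.

Lemma umean_exchange T U (X : T -> U -> R) :
  umean (fun t => umean (X t)) = umean (fun u => umean (X^~ u)).
Proof.
by rewrite /umean -!mulr_sumr exchange_big/= mulrCA.
Qed.

Lemma umean_tuple0 T (X : 0.-tuple T -> R) : umean X = X [tuple].
Proof.
rewrite -[RHS](@umean_cst (0.-tuple T)) ?card_tuple ?expn0//.
by apply: eq_umean => t; rewrite tuple0.
Qed.

(** This is how independence enters: the uniform law on tuples is a product, so the first draw can
    be averaged separately. It serves for single draws, inner iterations and epochs alike. *)
Lemma umean_tupleS T n (X : n.+1.-tuple T -> R) :
  umean X = umean (fun a => umean (fun t : n.-tuple T => X (cons_tuple a t))).
Proof.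
transitivity (umean (fun p : T * n.-tuple T => X (cons_tuple p.1 p.2))); last first.
  exact: umean_pair.
rewrite /umean card_prod !card_tuple expnS; congr (_ * _).
rewrite (reindex (fun p : T * n.-tuple T => cons_tuple p.1 p.2))//=.
exists (fun t : n.+1.-tuple T => (thead t, behead_tuple t)) => [[a t] _|t _].
  by congr (_, _); apply: val_inj.
by rewrite [RHS]tuple_eta; apply: val_inj.
Qed.

Lemma expectation_unifE T (X : T -> R) :
  expectation_unif (fun t => (X t)%:E) = (umean X)%:E.
Proof. by rewrite /expectation_unif sumEFin. Qed.

End UniformMean.

(** * Variance of a sample mean drawn with replacement *)

Section SampleVariance.
Context {R : realType} {n p : nat}.
Hypothesis n_gt0 : (0 < n)%N.

Let card_gt0 A : (0 < #|{: A.-tuple 'I_n}|)%N.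
Proof. by rewrite card_tuple card_ord expn_gt0 n_gt0. Qed.

(** Splitting off one draw leaves a cross term that is linear in that draw, and its mean vanishes
    because the [Y i] sum to zero. *)
Lemma umean_sqr_centered (Y : 'I_n -> 'rV[R]_p) (A : nat) : \sum_i Y i = 0 ->
  umean (fun t : A.-tuple 'I_n => enorm (\sum_(i <- t) Y i) ^+ 2)
  = A%:R * umean (fun i => enorm (Y i) ^+ 2).
Proof.
move=> Y0; elim: A => [|A IH].
  by rewrite umean_tuple0 big_nil enorm0 expr0n mul0r.
rewrite umean_tupleS.
under eq_umean => a.
  under eq_umean => t.
    rewrite big_cons sqr_enorm dotvDl !dotvDr -!sqr_enorm.
    rewrite (dotvC _ (Y a)) addrA -(addrA (enorm (Y a) ^+ 2)) -mulr2n.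
    rewrite -(mulr_natl (dotv _ _)); over.
  rewrite umeanD umeanD IH umean_cst ?card_gt0//; over.
rewrite umeanD umeanD umean_cst ?card_ord// -(natr1 A) mulrDl mul1r addrC.
suff -> : umean (fun a => umean (fun t : A.-tuple 'I_n =>
    2 * dotv (Y a) (\sum_(j <- t) Y j))) = 0 by rewrite addr0.
rewrite umean_exchange -[RHS](@umean_cst _ {: A.-tuple 'I_n}) ?card_gt0//.
apply: eq_umean => t; rewrite /umean -mulr_sumr.
under eq_bigr do rewrite dotvC.
by rewrite -dotv_sumr Y0 dotvC dotv0l !mulr0.
Qed.

(** Centering at the mean [M] reduces to additive variances, and the variance of one draw is at most
    its second moment. *)
Lemma sample_mean_variance (X : 'I_n -> 'rV[R]_p) (A : nat) (b : R) : (0 < A)%N ->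
  (forall i, enorm (X i) ^+ 2 <= b) ->
  umean (fun t : A.-tuple 'I_n =>
    enorm (A%:R^-1 *: \sum_(i <- t) X i - n%:R^-1 *: \sum_i X i) ^+ 2)
  <= b / A%:R.
Proof.
move=> A0 Xb; set M := n%:R^-1 *: _.
have nR : n%:R != 0 :> R by rewrite pnatr_eq0 -lt0n.
have AR : A%:R != 0 :> R by rewrite pnatr_eq0 -lt0n.
have MX : \sum_i X i = n%:R *: M by rewrite scalerA divff// scale1r.
pose Y i := X i - M.
have Y0 : \sum_i Y i = 0.
  by rewrite sumrB MX sumr_const card_ord -(scaler_nat n M) subrr.
rewrite (_ : (fun _ => _) = (fun t : A.-tuple 'I_n =>
    A%:R^-1 ^+ 2 * enorm (\sum_(i <- t) Y i) ^+ 2)); last first.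
  apply/funext => t; rewrite -exprMn -[A%:R^-1 in RHS]ger0_norm ?invr_ge0//.
  rewrite -enormZ sumrB scalerBr big_const_seq count_predT size_tuple iter_addr_0.
  by rewrite -[M *+ A]scaler_nat scalerA mulVf// scale1r.
rewrite umeanZ umean_sqr_centered// mulrA expr2 divfK// mulrC.
rewrite ler_wpM2r ?invr_ge0//.
have YX : \sum_i enorm (Y i) ^+ 2 = \sum_i enorm (X i) ^+ 2 - n%:R * enorm M ^+ 2.
  transitivity (\sum_i (enorm (X i) ^+ 2 - 2 * dotv M (X i) + enorm M ^+ 2)).
    apply: eq_bigr => i _; rewrite !sqr_enorm !dotv_lin (dotvC (X i)); ring.
  rewrite big_split/= sumrB -mulr_sumr -dotv_sumr MX dotvZr sumr_const card_ord.
  rewrite -sqr_enorm -(mulr_natl (_ ^+ 2)); ring.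
rewrite /umean card_ord YX ler_pdivrMl ?ltr0n// lerBlDr.
rewrite (le_trans (ler_sum _ (fun i _ => Xb i)))// sumr_const card_ord -(mulr_natl b).
by rewrite lerDl mulr_ge0// sqr_ge0.
Qed.

End SampleVariance.

(** * One iteration, pathwise *)

Lemma ext_convex_addEFin (R : realType) n (f : 'rV[R]_n -> R) (h : 'rV[R]_n -> \bar R) :
  convex_function [set: convex_lmodType 'rV[R]_n] f ->
  (forall x, (-oo < h x)%E) -> ext_convex h ->
  ext_convex (fun x => ((f x)%:E + h x)%E).
Proof.
move=> cf hNy ch x y t /andP[t0 t1].
have : f (t *: x + (1 - t) *: y) <= t * f x + (1 - t) * f y.
  have := cf (Itv01 t0 t1) x y; rewrite !inE => /(_ I I).
  by rewrite {1}/conv/= /unstable.onem; exact.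
rewrite -lee_fin => fxy.
have hxy := ch x y t; rewrite t0 t1 in hxy.
apply: (le_trans (leeD fxy (hxy isT))).
rewrite EFinD !EFinM.
by rewrite !muleDr// addeACA.
Qed.

(** Induction on the number of points, merging the average so far with the next point. Positivity of
    [w 0] keeps each partial sum [W] invertible. *)
Lemma ext_convex_jensen (R : realType) n (phi : 'rV[R]_n -> \bar R) (m : nat)
    (w : nat -> R) (p : nat -> 'rV[R]_n) :
  (forall x, (-oo < phi x)%E) -> ext_convex phi ->
  0 < w 0%N -> (forall j, 0 <= w j) ->
  (forall j, (j < m.+1)%N -> (phi (p j) < +oo)%E) ->
  let W := \sum_(j < m.+1) w j in let v := W^-1 *: \sum_(j < m.+1) w j *: p j in
  (phi v < +oo)%E /\ W * fine (phi v) <= \sum_(j < m.+1) w j * fine (phi (p j)).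
Proof.
move=> phiNy cphi w0 w_ge0.
have phiK x : (phi x < +oo)%E -> (fine (phi x))%:E = phi x.
  by move=> fx; apply: fineK; rewrite fin_numE gt_eqF ?lt_eqF.
elim: m => [|m IH] pfin /=.
  by rewrite !big_ord1 scalerA mulVf ?gt_eqF// scale1r; split => //; exact: pfin.
have /= [] := IH (fun j jm => pfin j (ltnW jm)).
rewrite [\sum_(j < m.+2) w j]big_ord_recr [\sum_(j < m.+2) _ *: _]big_ord_recr.
rewrite [\sum_(j < m.+2) _ * _]big_ord_recr/=.
set W := \sum_(j < m.+1) w j; set P := \sum_(j < m.+1) w j *: _.
set F := \sum_(j < m.+1) w j * _ => vfin vle.
have W0 : 0 < W.
  by rewrite /W big_ord_recl/= ltr_pwDl// sumr_ge0.
have wm := w_ge0 m.+1; have W'0 : 0 < W + w m.+1 by rewrite ltr_pwDl.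
have pm := pfin m.+1 (ltnSn _).
set t := W / (W + w m.+1).
have t01 : 0 <= t <= 1.
  by rewrite divr_ge0 ?(ltW W0) ?(ltW W'0)//= ler_pdivrMr// mul1r lerDl.
have := cphi (W^-1 *: P) (p m.+1) t t01.
have -> : t *: (W^-1 *: P) + (1 - t) *: p m.+1
    = (W + w m.+1)^-1 *: (P + w m.+1 *: p m.+1).
  rewrite scalerDr !scalerA; congr (_ *: _ + _ *: _); rewrite /t.
    by field; rewrite !gt_eqF.
  by field; rewrite gt_eqF.
rewrite -(phiK _ vfin) -(phiK _ pm) -!EFinM -EFinD => vle'.
have v'fin := le_lt_trans vle' (ltry _); split=> //.
move: vle'; rewrite -(phiK _ v'fin) lee_fin => vle'.
rewrite (le_trans (ler_wpM2l (ltW W'0) vle'))//.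
move: (fine (phi (p m.+1))) vle {vle'} => b vle; set a := fine _ in vle *.
have -> : (W + w m.+1) * (t * a + (1 - t) * b) = W * a + w m.+1 * b.
  by rewrite /t; field; rewrite gt_eqF.
by rewrite lerD2r.
Qed.

(* The sum of the hypotheses, weighted by [1], up to the terms that cancel. *)
Fact coupling_arith (R : realFieldType) (tau L mu c : R)
    (gz gz' gxt gy gy' gxs ez ez' ext ey ey' exs : R)
    (fx fy fy' fxt fxs hz' hxt hy hy' hv hxs N Z Z' Q E V : R) :
  0 <= V ->
  gy' + ey' + 3 * L / 2 * Q + hy' + V
    <= tau * gz' + tau * gxt + (1 - tau - tau) * gy
       + (tau * ez' + tau * ext + (1 - tau - tau) * ey)
       + 3 * L / 2 * (tau ^+ 2 * N) + hv ->
  tau * (gz' + ez' + 3 * tau * L / 2 * N + hz' + (3 * tau * L / 2 + mu / 2) * Z')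
    <= tau * (gxs + exs + 3 * tau * L / 2 * Z + hxs) ->
  hv <= tau * hz' + tau * hxt + (1 - tau - tau) * hy ->
  fy' <= fx + (gy' - (tau * gz + tau * gxt + (1 - tau - tau) * gy)) + L / 2 * Q ->
  tau * (fx + (gxs - (tau * gz + tau * gxt + (1 - tau - tau) * gy))) <= tau * fxs ->
  tau * (fx + (gxt - (tau * gz + tau * gxt + (1 - tau - tau) * gy))) <= tau * fxt ->
  (1 - tau - tau) * (fx + (gy - (tau * gz + tau * gxt + (1 - tau - tau) * gy)))
    <= (1 - tau - tau) * fy ->
  tau * ez + tau * ext + (1 - tau - tau) * ey - ey' <= c * E + L * Q ->
  fy' + hy' - (fxs + hxs) + tau * (3 * tau * L + mu) / 2 * Z'
  <= tau * (fxt + hxt - (fxs + hxs)) + (1 - 2 * tau) * (fy + hy - (fxs + hxs))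
     + 3 * tau ^+ 2 * L / 2 * Z + c * E - tau * (ez - exs).
Proof.
move=> H0 H1 H2 H3 H4 H5 H6 H7 H8.
rewrite -subr_ge0.
have := lerD (lerD (lerD (lerD (lerD (lerD (lerD H1 H2) H3) H4) H5) H6) H7) H8.
rewrite -subr_ge0 => H; apply: le_trans (addr_ge0 H0 H) _.
by rewrite le_eqVlt; apply/orP; left; apply/eqP; field.
Qed.

(** * Optimality gap and coupling of the two prox steps *)

Section CompositeMinimization.
Context {R : realType} {n : nat}.
Variables (f : 'rV[R]_n -> R) (h : 'rV[R]_n -> \bar R) (L mu : R) (xs : 'rV[R]_n).
Hypotheses (df : forall x, differentiable f x)
  (cf : convex_function [set: convex_lmodType 'rV[R]_n] f)
  (fL : smooth_fun L f) (mu_gt0 : 0 < mu) (mu_le_L : mu <= L)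
  (h_proper : proper_fun h) (h_lsc : lower_semicontinuous h)
  (h_convex : ext_convex h) (h_mu : strongly_convex mu h)
  (xs_fin : (h xs < +oo)%E)
  (xs_min : minimizer (fun x => ((f x)%:E + h x)%E) xs).

(** Real-valued so that linear arithmetic applies; since [fine] sends [+oo] to 0, it is the true gap
    only where [h u] is finite, whence the finiteness conditions carried along. *)
Definition gap u := f u + fine (h u) - (f xs + fine (h xs)).

(** At the minimizer [- grad f xs] is a subgradient of [h], so the linear term cancels against the
    tangent bound of the convex [f]. *)
Lemma gap_ge u : (h u < +oo)%E -> mu / 2 * enorm (u - xs) ^+ 2 <= gap u.
Proof.
move=> hu; have := h_mu u (minimizer_subgradient h_proper h_convex (df xs) xs_fin xs_min).
rewrite -(proper_fineK h_proper hu) -(proper_fineK h_proper xs_fin) -EFinD lee_fin.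
by have := convex_grad_le u (df xs) cf; rewrite dotvNl /gap /=; lra.
Qed.

Lemma gap_ge0 u : (h u < +oo)%E -> 0 <= gap u.
Proof.
by move=> /gap_ge; apply: le_trans; rewrite mulr_ge0 ?sqr_ge0// divr_ge0// ltW.
Qed.

Lemma gap_jensen (m : nat) (w : nat -> R) (p : nat -> 'rV[R]_n) :
  0 < w 0%N -> (forall j, 0 <= w j) ->
  (forall j, (j < m.+1)%N -> (h (p j) < +oo)%E) ->
  let W := \sum_(j < m.+1) w j in let v := W^-1 *: \sum_(j < m.+1) w j *: p j in
  (h v < +oo)%E /\ W * gap v <= \sum_(j < m.+1) w j * gap (p j).
Proof.
move=> w0 wge0 pfin.
pose phi x := ((f x)%:E + h x)%E.
have hNy : forall x, (-oo < h x)%E by case: h_proper.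
have phiNy x : (-oo < phi x)%E by rewrite /phi; case: (h x) (hNy x) => // r _; rewrite ltNyr.
have phifin x : (phi x < +oo)%E = (h x < +oo)%E.
  by rewrite /phi; case: (h x) (hNy x) => // r _; rewrite !ltry.
have phiE x : (h x < +oo)%E -> fine (phi x) = f x + fine (h x).
  by move=> hx; rewrite /phi -(proper_fineK h_proper hx).
have cphi : ext_convex phi by exact: ext_convex_addEFin.
have pf j : (j < m.+1)%N -> (phi (p j) < +oo)%E by rewrite phifin; exact: pfin.
have /= [] := @ext_convex_jensen _ _ phi m w p phiNy cphi w0 wge0 pf.
rewrite phifin => vfin vle; split=> //; move: vle; rewrite phiE// /gap mulrBr.
have -> : \sum_(j < m.+1) w j * fine (phi (p j))
    = \sum_(j < m.+1) w j * (f (p j) + fine (h (p j))).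
  by apply: eq_bigr => j _; rewrite phiE// pfin.
move=> vle; under [leRHS]eq_bigr do rewrite mulrBr.
by rewrite sumrB -mulr_suml lerD2r.
Qed.

Lemma prox_exists d z c : 0 < c ->
  minimizer (fun u => ((dotv d u + c * enorm (u - z) ^+ 2)%:E + h u)%E)
    (argmin (fun u => ((dotv d u + c * enorm (u - z) ^+ 2)%:E + h u)%E)).
Proof.
move=> c0; apply: quadratic_argmin => //; first exact: xs_fin.
exact: (minimizer_subgradient h_proper h_convex (df xs) xs_fin xs_min).
Qed.

(* The point [v] makes [v - x = tau * (z' - z)], so that the prox step [y'] does
   at least as well as a step in the direction of the mirror step [z']. *)
Lemma coupling_step (tau : R) (xt y z d : 'rV[R]_n) :
  0 < tau -> tau <= 2^-1 -> (h xt < +oo)%E -> (h y < +oo)%E ->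
  let x := tau *: z + tau *: xt + (1 - tau - tau) *: y in
  let e := d - grad f x in
  let z' := argmin (fun u =>
    ((dotv d u + 3 * tau * L / 2 * enorm (u - z) ^+ 2)%:E + h u)%E) in
  let y' := argmin (fun u =>
    ((dotv d u + 3 * L / 2 * enorm (u - x) ^+ 2)%:E + h u)%E) in
  (h y' < +oo)%E /\
  gap y' + tau * (3 * tau * L + mu) / 2 * enorm (z' - xs) ^+ 2
  <= tau * gap xt + (1 - 2 * tau) * gap y
     + 3 * tau ^+ 2 * L / 2 * enorm (z - xs) ^+ 2
     + (4 * L)^-1 * enorm e ^+ 2 - tau * dotv e (z - xs).
Proof.
move=> tau0 tau2; have t2 : 0 <= 1 - tau - tau by lra.
move=> hxt hy x e z' y'.
have L0 : 0 < L by exact: lt_le_trans mu_gt0 mu_le_L.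
have cz : 0 < 3 * tau * L / 2 by rewrite divr_gt0 ?mulr_gt0.
have cy : 0 < 3 * L / 2 by rewrite divr_gt0 ?mulr_gt0.
have zmin := prox_exists d z cz; rewrite -/z' in zmin.
have ymin := prox_exists d x cy; rewrite -/y' in ymin.
have [hz' Pz] := prox_le h_proper h_convex h_mu xs_fin zmin.
pose v := tau *: z' + tau *: xt + (1 - tau - tau) *: y.
have [hv hvle] : (h v < +oo)%E /\ fine (h v) <=
    tau * fine (h z') + tau * fine (h xt) + (1 - tau - tau) * fine (h y).
  have hNy : forall u, (-oo < h u)%E by case: h_proper.
  have := @ext_convex_jensen _ _ h 2 (nth 0 [:: tau; tau; 1 - tau - tau])
    (nth 0 [:: z'; xt; y]) hNy h_convex tau0.
  rewrite /= !big_ord_recr !big_ord0/= !add0r.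
  rewrite (_ : tau + tau + (1 - tau - tau) = 1); last by ring.
  rewrite invr1 scale1r mul1r; apply => -[|[|[|j]]]//=.
  - exact: ltW.
  - exact: ltW.
  - by rewrite nth_nil.
have [hy' Py] := prox_le h_proper h_convex h_mu hv ymin.
split => //.
have vx : enorm (v - x) ^+ 2 = tau ^+ 2 * enorm (z' - z) ^+ 2.
  have -> : v - x = tau *: (z' - z).
    by apply/rowP => i; rewrite !mxE; ring.
  by rewrite enormZ exprMn real_normK ?num_real.
have yx : 0 <= (3 * L / 2 + mu / 2) * enorm (v - y') ^+ 2.
  by rewrite mulr_ge0 ?sqr_ge0// addr_ge0 ?divr_ge0 ?mulr_ge0// ltW.
have Pf := descent_lemma x y' df fL.
have C1 := convex_grad_le xs (df x) cf.
have C2 := convex_grad_le xt (df x) cf.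
have C3 := convex_grad_le y (df x) cf.
(* This Young weight charges [L * |y' - x|^2]; with the [L / 2] of the descent lemma it uses up
   exactly the [3 * L / 2] of the prox step. *)
have c0 : 0 < (2 * L)^-1 by rewrite invr_gt0 mulr_gt0.
have Ye := le_trans (ler_norm _) (dotv_young e (x - y') c0).
rewrite (_ : (2 * L)^-1 / 2 = (4 * L)^-1) in Ye; last by field; rewrite gt_eqF.
rewrite (_ : (2 * (2 * L)^-1)^-1 = L) in Ye; last by field; rewrite gt_eqF.
have yxE : enorm (x - y') = enorm (y' - x) by rewrite -enormN opprB.
have Zs : enorm (xs - z') = enorm (z' - xs) by rewrite -enormN opprB.
have Zz : enorm (xs - z) = enorm (z - xs) by rewrite -enormN opprB.
rewrite yxE in Ye; rewrite vx in Py; rewrite Zs Zz in Pz.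
have C1' := ler_wpM2l (ltW tau0) C1; have C2' := ler_wpM2l (ltW tau0) C2.
have C3' := ler_wpM2l t2 C3; have Pz' := ler_wpM2l (ltW tau0) Pz.
have dE u : dotv d u = dotv (grad f x) u + dotv e u.
  by rewrite -dotvDl /e addrC subrK.
have xE u : dotv u x = tau * dotv u z + tau * dotv u xt + (1 - tau - tau) * dotv u y.
  by rewrite /x !dotv_lin.
have vE u : dotv u v = tau * dotv u z' + tau * dotv u xt + (1 - tau - tau) * dotv u y.
  by rewrite /v !dotv_lin.
have dB (w a b : 'rV[R]_n) : dotv w (a - b) = dotv w a - dotv w b.
  by rewrite dotvDr dotvNr.
rewrite !dE !vE in Py; rewrite !dE in Pz'.
rewrite dB xE in Pf; rewrite dB xE in C1'; rewrite dB xE in C2'.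
rewrite dB xE in C3'; rewrite dB xE in Ye; rewrite dB.
exact: coupling_arith yx Py Pz' hvle Pf C1' C2' C3' Ye.
Qed.

End CompositeMinimization.

(** * Error of the gradient estimator *)

(** The direction [d] computed inside [sock_step], isolated so that its error can be bounded
    independently of the prox steps. *)
Definition grad_estimator {R : realType} {n1 n2 N1 N2 : nat}
    (Fi : 'I_n1 -> 'rV[R]_N1 -> R) (Gj : 'I_n2 -> 'rV[R]_N2 -> 'rV[R]_N1)
    (A B : nat) (xt x : 'rV[R]_N2) (w : draw (n2 := n2) A B) : 'rV[R]_N2 :=
  let Ghat := A%:R^-1 *: (\sum_(i <- w.1) (Gj i x - Gj i xt)) + avg_map Gj xt in
  let JGhat := B%:R^-1 *: (\sum_(i <- w.2) ('J (Gj i) x - 'J (Gj i) xt))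
               + 'J (avg_map Gj) xt in
  grad (avg_fun Fi) Ghat *m JGhat^T.

Section GradientError.
Context {R : realType} {n1 n2 N1 N2 : nat}.
Variables (Fi : 'I_n1 -> 'rV[R]_N1 -> R) (Gj : 'I_n2 -> 'rV[R]_N2 -> 'rV[R]_N1).
Variables (L_F B_F L_G B_G : R).
Hypotheses (n1_gt0 : (0 < n1)%N) (n2_gt0 : (0 < n2)%N).
Hypothesis dF : forall i u, differentiable (Fi i) u.
Hypothesis dG : forall j x, differentiable (Gj j) x.
Hypothesis F_smooth : forall i, smooth_fun L_F (Fi i).
Hypothesis F_bounded : forall i, bounded_grad B_F (Fi i).
Hypothesis G_smooth : forall j, smooth_map L_G (Gj j).
Hypothesis G_bounded : forall j, bounded_jacobian B_G (Gj j).

Let tuple_gt0 A : (0 < #|{: A.-tuple 'I_n2}|)%N.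
Proof. by rewrite card_tuple card_ord expn_gt0 n2_gt0. Qed.

Lemma value_error (A : nat) (xt x : 'rV[R]_N2) : (0 < A)%N ->
  umean (fun t : A.-tuple 'I_n2 =>
    enorm (A%:R^-1 *: (\sum_(i <- t) (Gj i x - Gj i xt)) + avg_map Gj xt
           - avg_map Gj x) ^+ 2)
  <= B_G ^+ 2 * enorm (x - xt) ^+ 2 / A%:R.
Proof.
move=> A0; rewrite (_ : (fun _ => _) = (fun t : A.-tuple 'I_n2 =>
    enorm (A%:R^-1 *: \sum_(i <- t) (Gj i x - Gj i xt)
           - n2%:R^-1 *: \sum_i (Gj i x - Gj i xt)) ^+ 2)); last first.
  apply/funext => t; rewrite -addrA; congr (enorm (_ + _) ^+ 2).
  by rewrite sumrB scalerBr opprB.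
apply: (@sample_mean_variance _ _ _ n2_gt0 (fun i => Gj i x - Gj i xt)) => // i.
rewrite -exprMn ler_sqr ?nnegrE ?enorm_ge0//; first exact: jacobian_lipschitz.
exact: le_trans (enorm_ge0 _) (jacobian_lipschitz _ _ (dG i) (G_bounded i)).
Qed.

(* For a fixed [u] the error is a vector, so that its variance is additive even
   though the spectral norm is not Euclidean. *)
Lemma jacobian_error (B : nat) (xt x : 'rV[R]_N2) (u : 'rV[R]_N1) : (0 < B)%N ->
  umean (fun t : B.-tuple 'I_n2 =>
    enorm (u *m (B%:R^-1 *: (\sum_(i <- t) ('J (Gj i) x - 'J (Gj i) xt))
           + 'J (avg_map Gj) xt - 'J (avg_map Gj) x)^T) ^+ 2)
  <= enorm u ^+ 2 * L_G ^+ 2 * enorm (x - xt) ^+ 2 / B%:R.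
Proof.
move=> B0; pose X i := u *m ('J (Gj i) x - 'J (Gj i) xt)^T.
rewrite (_ : (fun _ => _) = (fun t : B.-tuple 'I_n2 =>
    enorm (B%:R^-1 *: \sum_(i <- t) X i - n2%:R^-1 *: \sum_i X i) ^+ 2)).
  apply: (sample_mean_variance n2_gt0) => // i.
  rewrite -!exprMn ler_sqr ?nnegrE ?enorm_ge0//.
    apply: le_trans (enorm_mulmxT_le _ _) _; rewrite mulrC -mulrA ler_wpM2l ?enorm_ge0//.
    exact: G_smooth.
  rewrite -mulrA mulr_ge0 ?enorm_ge0//.
  exact: le_trans (spectral_norm_ge0 _) (G_smooth i x xt).
apply/funext => t; congr (enorm _ ^+ 2).
rewrite -addrA linearD/= mulmxDr; congr (_ + _).
  by rewrite linearZ/= -scalemxAr linear_sum/= mulmx_sumr.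
rewrite !jacobian_avg// -scalerBr -sumrB linearZ/= -scalemxAr linear_sum/=.
rewrite mulmx_sumr -scalerN -sumrN; congr (_ *: _); apply: eq_bigr => i _.
by rewrite -mulmxN -linearN/= opprB.
Qed.

(** The error splits into [u] times the Jacobian error plus the error of [u] times the exact
    Jacobian. Once the value sample is fixed, [u] is constant with respect to the independent
    Jacobian sample. Of [B_G ^+ 4], one square bounds the exact Jacobian and the other is the
    Lipschitz constant of the [Gj]. *)
Lemma grad_estimator_error (A B : nat) (xt x : 'rV[R]_N2) : (0 < A)%N -> (0 < B)%N ->
  umean (fun w : draw (n2 := n2) A B =>
    enorm (grad_estimator Fi Gj xt x w - grad (smooth_part Fi Gj) x) ^+ 2)
  <= 2 * (B_F ^+ 2 * L_G ^+ 2 / B%:R + B_G ^+ 4 * L_F ^+ 2 / A%:R)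
     * enorm (x - xt) ^+ 2.
Proof.
move=> A0 B0; rewrite umean_pair/=.
pose eG (t : A.-tuple 'I_n2) := A%:R^-1 *: (\sum_(i <- t) (Gj i x - Gj i xt))
  + avg_map Gj xt - avg_map Gj x.
pose b := B_F ^+ 2 * L_G ^+ 2 * enorm (x - xt) ^+ 2 / B%:R.
apply: (@le_trans _ _ (umean (fun t : A.-tuple 'I_n2 =>
    2 * b + 2 * (B_G ^+ 2 * L_F ^+ 2) * enorm (eG t) ^+ 2))); last first.
  rewrite umeanD umean_cst// umeanZ.
  have LB0 : 0 <= 2 * (B_G ^+ 2 * L_F ^+ 2) by rewrite mulr_ge0// mulr_ge0 ?sqr_ge0.
  have := ler_wpM2l LB0 (value_error xt x A0); rewrite -/eG => H.
  apply: le_trans (lerD (lexx _) H) _; rewrite /b le_eqVlt; apply/orP; left.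
  by apply/eqP; field; rewrite !pnatr_eq0 -!lt0n A0 B0.
apply: umean_le => t.
pose Gh := A%:R^-1 *: (\sum_(i <- t) (Gj i x - Gj i xt)) + avg_map Gj xt.
pose u := grad (avg_fun Fi) Gh.
pose eJ (s : B.-tuple 'I_n2) := B%:R^-1 *: (\sum_(i <- s) ('J (Gj i) x - 'J (Gj i) xt))
  + 'J (avg_map Gj) xt - 'J (avg_map Gj) x.
have ub : enorm u <= B_F by exact: bounded_grad_avg.
apply: (@le_trans _ _ (umean (fun s : B.-tuple 'I_n2 =>
    2 * enorm (u *m (eJ s)^T) ^+ 2 + 2 * (B_G ^+ 2 * L_F ^+ 2) * enorm (eG t) ^+ 2))).
  apply: umean_le => s; rewrite grad_smooth_part// /grad_estimator /= -/Gh -/u.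
  set JGh := _ + 'J _ xt.
  have -> : u *m JGh^T - grad (avg_fun Fi) (avg_map Gj x) *m ('J (avg_map Gj) x)^T
      = u *m (eJ s)^T + (u - grad (avg_fun Fi) (avg_map Gj x)) *m ('J (avg_map Gj) x)^T.
    by rewrite /eJ -/JGh linearB/= mulmxBr mulmxBl subrKA.
  apply: le_trans (sqr_enormD_le _ _) _; rewrite lerD2l -[leRHS]mulrA ler_pM2l//.
  rewrite -exprMn -exprMn -mulrA.
  rewrite ler_sqr ?nnegrE ?enorm_ge0//.
    apply: le_trans (enorm_mul_jacobian_avgT n2_gt0 dG _ _ G_bounded) _.
    (* The sign of [B_G] is read off from the first component, whose Jacobian norm it bounds. *)
    rewrite ler_wpM2l//; first exact: le_trans (spectral_norm_ge0 _) (G_bounded (Ordinal n2_gt0) x).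
    exact: smooth_fun_avg.
  rewrite mulr_ge0//; first exact: le_trans (spectral_norm_ge0 _) (G_bounded (Ordinal n2_gt0) x).
  apply: le_trans (enorm_ge0 _) (smooth_fun_avg n1_gt0 _ F_smooth Gh (avg_map Gj x)).
  exact: dF.
rewrite umeanD umeanZ umean_cst// lerD2r ler_pM2l//.
apply: le_trans (jacobian_error xt x u B0) _.
rewrite /b ler_wpM2r ?invr_ge0// ler_wpM2r ?sqr_ge0// ler_wpM2r ?sqr_ge0//.
by rewrite ler_sqr ?nnegrE ?enorm_ge0// (le_trans (enorm_ge0 _) ub).
Qed.

End GradientError.

(** * Epochs *)

Section Epochs.
Context {R : realType} {n : nat} {T : finType}.
Local Notation V := 'rV[R]_n.
Variables (step : V -> V * V -> T -> V * V) (fin : V -> Prop) (gap sqd : V -> R).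
Variables (m' : nat) (theta c r q : R).
Let m := m'.+1.

Hypotheses (T_gt0 : (0 < #|T|)%N) (theta_gt0 : 0 < theta).
Hypotheses (c_ge0 : 0 <= c) (r_ge0 : 0 <= r) (q_ge0 : 0 <= q).
Hypothesis gap_ge0 : forall u, fin u -> 0 <= gap u.
Hypothesis sqd_ge0 : forall u, 0 <= sqd u.
Hypothesis gap_jensen : forall (w : nat -> R) (p : nat -> V),
  0 < w 0%N -> (forall j, 0 <= w j) -> (forall j, (j < m)%N -> fin (p j)) ->
  let W := \sum_(j < m) w j in let v := W^-1 *: \sum_(j < m) w j *: p j in
  fin v /\ W * gap v <= \sum_(j < m) w j * gap (p j).
Hypothesis step_fin : forall xt y z w, fin xt -> fin y -> fin (step xt (y, z) w).1.
Hypothesis step_le : forall xt y z, fin xt -> fin y ->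
  umean (fun w => gap (step xt (y, z) w).1 + q * sqd (step xt (y, z) w).2)
  <= c * gap xt + r * gap y + q / theta * sqd z.
(** After telescoping, [1 - r * theta] is the coefficient left on the weighted gaps; it has to pay
    for the next snapshot coefficient [c], enlarged by the epoch gain. *)
Hypothesis contraction : c * theta ^+ m <= 1 - r * theta.

(** Same body as [sock_epoch] with an arbitrary step, so that the results apply to [sock] by
    conversion. *)
Let epoch (st : V * (V * V)) (ws : m.-tuple T) : V * (V * V) :=
  let: (xt, yz) := st in
  let tr := scanl (step xt) yz ws in
  ((\sum_(j < m) theta ^+ j)^-1 *: \sum_(j < m) theta ^+ j *: (nth yz tr j).1,
   last yz tr).

Let Theta := \sum_(j < m) theta ^+ j.
Let potential (st : V * (V * V)) :=
  c * Theta * gap st.1 + r * gap st.2.1 + q / theta * sqd st.2.2.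

Lemma scanl_fin xt yz (ws : seq T) : fin xt -> fin yz.1 ->
  let tr := scanl (step xt) yz ws in
  (forall j, (j < size ws)%N -> fin (nth yz tr j).1) /\ fin (last yz tr).1.
Proof.
move=> xtfin; elim: ws yz => [|w ws IH] [y z] //= yfin.
have [IH1 IH2] := IH (step xt (y, z) w) (step_fin z w xtfin yfin).
split=> // -[|j] /= jn; first exact: step_fin.
by rewrite (set_nth_default (step xt (y, z) w)) ?size_scanl//; exact: IH1.
Qed.

(* Weighting iteration [j] by [theta ^+ j] makes the terms in [r * gap y_j] and
   [q / theta * sqd z_j] telescope. *)
Lemma trajectory_le (k : nat) xt yz : fin xt -> fin yz.1 ->
  umean (fun ws : k.-tuple T => let tr := scanl (step xt) yz ws in
    (1 - r * theta) * (\sum_(j < k) theta ^+ j * gap (nth yz tr j).1)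
    + theta ^+ k * (r * gap (last yz tr).1 + q / theta * sqd (last yz tr).2))
  <= c * (\sum_(j < k) theta ^+ j) * gap xt
     + (r * gap yz.1 + q / theta * sqd yz.2).
Proof.
move=> xtfin; elim: k yz => [|k IH] [y z] /= yfin.
  by rewrite umean_tuple0 /= !big_ord0 mulr0 mulr0 mul0r !add0r expr0 mul1r.
rewrite umean_tupleS.
pose rest yz (ws : k.-tuple T) := let tr := scanl (step xt) yz ws in
    (1 - r * theta) * (\sum_(j < k) theta ^+ j * gap (nth yz tr j).1)
    + theta ^+ k * (r * gap (last yz tr).1 + q / theta * sqd (last yz tr).2).
have kT : (0 < #|{: k.-tuple T}|)%N by rewrite card_tuple expn_gt0 T_gt0.
have E w (ws : k.-tuple T) : let tr := scanl (step xt) (y, z) (cons_tuple w ws) in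
    (1 - r * theta) * (\sum_(j < k.+1) theta ^+ j * gap (nth (y, z) tr j).1)
    + theta ^+ k.+1 * (r * gap (last (y, z) tr).1 + q / theta * sqd (last (y, z) tr).2)
  = (1 - r * theta) * gap (step xt (y, z) w).1
    + theta * rest (step xt (y, z) w) ws.
  rewrite /= big_ord_recl/= expr0 mul1r mulrDr -addrA; congr (_ + _).
  rewrite /rest/= [RHS]mulrDr; congr (_ + _); last by rewrite exprS mulrA.
  rewrite [RHS]mulrCA [X in _ = _ * X]mulr_sumr; congr (_ * _).
  apply: eq_bigr => j _; rewrite exprS -mulrA; congr (_ * (_ * gap _.1)).
  by rewrite add0n; apply: set_nth_default; rewrite size_scanl size_tuple.
pose S := \sum_(j < k) theta ^+ j.
apply: (@le_trans _ _ (umean (fun w => theta * (c * S * gap xt) +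
    (gap (step xt (y, z) w).1 + q * sqd (step xt (y, z) w).2)))).
  apply: umean_le => w; rewrite (eq_umean (E w)) umeanD umean_cst// umeanZ.
  have := IH (step xt (y, z) w) (step_fin z w xtfin yfin).
  rewrite -/(rest _) -/S => /(ler_wpM2l (ltW theta_gt0)) H.
  apply: le_trans (lerD (lexx _) H) _.
  rewrite le_eqVlt; apply/orP; left; apply/eqP; field.
  by rewrite gt_eqF.
rewrite umeanD umean_cst//; apply: le_trans (lerD (lexx _) (step_le z xtfin yfin)) _.
rewrite big_ord_recl expr0 [X in 1 + X](_ : _ = theta * S).
  by rewrite le_eqVlt; apply/orP; left; apply/eqP; ring.
by rewrite mulr_sumr; apply: eq_bigr => j _; rewrite exprS.
Qed.

Lemma epoch_fin st ws : fin st.1 -> fin st.2.1 ->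
  [/\ fin (epoch st ws).1, fin (epoch st ws).2.1 &
    Theta * gap (epoch st ws).1
      <= \sum_(j < m) theta ^+ j * gap (nth st.2 (scanl (step st.1) st.2 ws) j).1].
Proof.
case: st => xt yz /= xtfin yfin.
have [trfin lastfin] := scanl_fin ws xtfin yfin.
rewrite size_tuple in trfin.
have [||//|] := gap_jensen (w := fun j => theta ^+ j)
  (p := fun j => (nth yz (scanl (step xt) yz ws) j).1); last by split.
- by rewrite expr0.
- by move=> j; rewrite exprn_ge0// ltW.
Qed.

(** The trajectory bound starts from exactly [potential st]. Jensen turns its weighted gaps into
    [Theta] times the gap of the new snapshot, and [contraction] extracts [theta ^+ m] from their
    coefficient. *)
Lemma epoch_contracts st : fin st.1 -> fin st.2.1 ->
  theta ^+ m * umean (fun ws => potential (epoch st ws)) <= potential st.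
Proof.
move=> xtfin yfin; have := trajectory_le m xtfin yfin.
rewrite -/Theta addrA => /(le_trans _); apply; rewrite -umeanZ; apply: umean_le => ws.
have [xfin' yfin' jens] := epoch_fin ws xtfin yfin.
case: st xtfin yfin xfin' yfin' jens => xt yz /= xtfin yfin xfin' yfin' jens.
set tr := scanl _ _ _ in xfin' jens *; rewrite /potential /=.
set v := _ *: _ in xfin' jens *.
rewrite -addrA mulrDr lerD2r.
have thm : 0 <= theta ^+ m by rewrite exprn_ge0// ltW.
have TG : 0 <= Theta * gap v.
  rewrite mulr_ge0 ?gap_ge0//; apply: sumr_ge0 => j _; rewrite exprn_ge0//.
  exact: ltW.
rewrite -mulrA mulrA (mulrC _ c); apply: (le_trans (ler_wpM2r TG contraction)).
by rewrite ler_wpM2l//; apply: le_trans contraction; rewrite mulr_ge0.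
Qed.

Lemma epochs_contract S st : fin st.1 -> fin st.2.1 ->
  (theta ^+ m) ^+ S * umean (fun ws : S.-tuple (m.-tuple T) =>
    potential (foldl epoch st ws)) <= potential st.
Proof.
elim: S st => [|S IH] st xtfin yfin.
  by rewrite umean_tuple0 expr0 mul1r.
rewrite umean_tupleS exprSr -mulrA.
apply: (le_trans _ (epoch_contracts xtfin yfin)).
have thm : 0 <= theta ^+ m by rewrite exprn_ge0// ltW.
rewrite mulrCA ler_wpM2l// -umeanZ; apply: umean_le => ws.
by have [xfin' yfin' _] := epoch_fin ws xtfin yfin; exact: IH.
Qed.

Lemma epochs_fin st (ws : seq (m.-tuple T)) : fin st.1 -> fin st.2.1 ->
  fin (foldl epoch st ws).1 /\ fin (foldl epoch st ws).2.1.
Proof.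
elim: ws st => [|w ws IH] st xtfin yfin //=.
by have [xfin' yfin' _] := epoch_fin w xtfin yfin; exact: IH.
Qed.

Lemma epochs_gap_le S x0 : fin x0 ->
  (theta ^+ m) ^+ S * (c * Theta * umean (fun ws : S.-tuple (m.-tuple T) =>
    gap (foldl epoch (x0, (x0, x0)) ws).1))
  <= c * Theta * gap x0 + r * gap x0 + q / theta * sqd x0.
Proof.
move=> x0fin; apply: le_trans (@epochs_contract S (x0, (x0, x0)) x0fin x0fin).
have thS : 0 <= theta ^+ m ^+ S by rewrite !exprn_ge0// ltW.
rewrite ler_wpM2l// -umeanZ; apply: umean_le => ws.
have [_ yfin'] := epochs_fin ws (st := (x0, (x0, x0))) x0fin x0fin.
rewrite /potential -addrA lerDl addr_ge0// mulr_ge0// ?gap_ge0//.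
by rewrite divr_ge0// ltW.
Qed.

End Epochs.

(** * One iteration in expectation *)

(** Convexity of the square with the missing weight [1 - a - b] placed at 0. It is meant for
    [x - xt], where the snapshot's own weight disappears. *)
Lemma sqr_enorm_comb2_le (R : realType) n (u v : 'rV[R]_n) (a b : R) :
  0 <= a -> 0 <= b -> a + b <= 1 ->
  enorm (a *: u + b *: v) ^+ 2 <= a * enorm u ^+ 2 + b * enorm v ^+ 2.
Proof.
move=> a0 b0 ab; have ab0 : 0 <= 1 - a - b by lra.
rewrite -subr_ge0 !sqr_enorm !dotv_lin (dotvC v u).
have E : 0 <= a * b * (dotv u u - 2 * dotv u v + dotv v v).
  have := dotvv_ge0 (u - v); rewrite !dotv_lin (dotvC v u) => uv.
  rewrite !mulr_ge0//; lra.
have U := mulr_ge0 (mulr_ge0 a0 ab0) (dotvv_ge0 u).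
have V := mulr_ge0 (mulr_ge0 b0 ab0) (dotvv_ge0 v).
apply: le_trans (addr_ge0 (addr_ge0 E U) V) _.
by rewrite le_eqVlt; apply/orP; left; apply/eqP; ring.
Qed.

(** The error term [X] is redistributed: its [Y] and [W] parts become [11 / 180 * tau] of the gaps
    by strong convexity, and its [Z] part must fit, together with the loss from dividing by [theta],
    into what the bias left of the surplus. *)
Fact step_arith (R : realFieldType) (tau L mu theta D Dt Z Y W X : R) :
  0 < tau -> tau <= 2^-1 -> 0 < mu -> tau ^+ 2 * L <= mu ->
  theta = 1 + tau / 6 ->
  0 <= Z -> mu / 2 * Y <= D -> mu / 2 * W <= Dt -> X <= 2 * tau * Z + 2 * Y + 2 * W ->
  tau * Dt + (1 - 2 * tau) * D + (3 * tau ^+ 2 * L / 2 + tau * mu / 8) * Z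
    + 11 / 720 * mu * tau * X
  <= tau * (1 + 11 / 180) * Dt + (1 - 2 * tau + 11 / 180 * tau) * D
     + tau * (3 * tau * L + mu) / 2 / theta * Z.
Proof.
move=> t0 t2 mu0 tL -> Z0 YD WD XZ.
have c0 : 0 < 11 / 720 :> R by lra.
have mt := mulr_gt0 (mulr_gt0 c0 mu0) t0.
have H1 := ler_wpM2l (ltW mt) XZ.
have H2 := ler_wpM2l (ltW t0) YD; have H3 := ler_wpM2l (ltW t0) WD.
have th0 : 0 < 1 + tau / 6 by lra.
have H4 : (3 * tau ^+ 2 * L / 2 + tau * mu / 8 + 11 / 360 * mu * tau ^+ 2)
    <= tau * (3 * tau * L + mu) / 2 / (1 + tau / 6).
  rewrite ler_pdivlMr//.
  have h3 := ler_wpM2l (ltW t0) tL; rewrite -subr_ge0 in h3.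
  have tmu : 0 < tau * mu by rewrite mulr_gt0.
  have h1 : tau ^+ 2 * mu <= tau * mu / 2 by rewrite expr2; nra.
  have h2 : tau ^+ 3 * mu <= tau * mu / 4.
    rewrite (_ : tau ^+ 3 * mu = tau * (tau ^+ 2 * mu)); last by ring.
    by have := ler_wpM2l (ltW t0) h1; lra.
  rewrite -subr_ge0 (_ : _ - _ = (tau * mu - tau * (tau ^+ 2 * L)) / 4
      + (tau * mu / 8 - (1 / 48 + 11 / 360) * (tau ^+ 2 * mu)
         - 11 / 2160 * (tau ^+ 3 * mu))); last by field.
  apply: addr_ge0; lra.
have H5 := ler_wpM2r Z0 H4.
lra.
Qed.

Fact comb_arith (R : realFieldType) (tau Z Y W V U : R) :
  0 <= tau -> tau <= 2^-1 -> 0 <= Y -> 0 <= W ->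
  V <= 2 * Z + 2 * W -> U <= 2 * Y + 2 * W ->
  tau * V + (1 - tau - tau) * U <= 2 * tau * Z + 2 * Y + 2 * W.
Proof.
move=> t0 t2 Y0 W0 VZ UY; have s0 : 0 <= 1 - tau - tau by lra.
have := ler_wpM2l t0 VZ; have := ler_wpM2l s0 UY.
have := mulr_ge0 t0 Y0; have := mulr_ge0 t0 W0; lra.
Qed.

Section SoCKStep.
Context {R : realType} {n1 n2 N1 N2 : nat}.
Variables (Fi : 'I_n1 -> 'rV[R]_N1 -> R) (Gj : 'I_n2 -> 'rV[R]_N2 -> 'rV[R]_N1).
Variables (h : 'rV[R]_N2 -> \bar R) (L_F B_F L_G B_G L mu : R) (xs : 'rV[R]_N2).
Hypotheses (n1_gt0 : (0 < n1)%N) (n2_gt0 : (0 < n2)%N).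
Hypothesis dF : forall i u, differentiable (Fi i) u.
Hypothesis dG : forall j x, differentiable (Gj j) x.
Hypotheses (h_proper : proper_fun h) (h_lsc : lower_semicontinuous h)
  (h_convex : ext_convex h).
Hypothesis cf : convex_function [set: convex_lmodType 'rV[R]_N2] (smooth_part Fi Gj).
Hypotheses (mu_gt0 : 0 < mu) (h_mu : strongly_convex mu h).
Hypothesis F_smooth : forall i, smooth_fun L_F (Fi i).
Hypothesis F_bounded : forall i, bounded_grad B_F (Fi i).
Hypothesis G_smooth : forall j, smooth_map L_G (Gj j).
Hypothesis G_bounded : forall j, bounded_jacobian B_G (Gj j).
Hypothesis FG_smooth : forall i j x y,
  enorm (grad (Fi i) (avg_map Gj x) *m ('J (Gj j) x)^T
         - grad (Fi i) (avg_map Gj y) *m ('J (Gj j) y)^T) <= L * enorm (x - y).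
Hypothesis mu_le_L : mu <= L.
Hypothesis xs_fin : (h xs < +oo)%E.
Hypothesis xs_min : minimizer (objective Fi Gj h) xs.

Variables (m' A B : nat) (tau theta : R).
Let m := m'.+1.
Hypotheses (A_gt0 : (0 < A)%N) (B_gt0 : (0 < B)%N).
Hypothesis A_large : B_G ^+ 4 * L_F ^+ 2 / A%:R <= mu ^+ 2 / 720.
Hypothesis B_large : B_F ^+ 2 * L_G ^+ 2 / B%:R <= mu ^+ 2 / 720.
Hypothesis tauE : tau = (2 * m%:R)^-1.
Hypothesis thetaE : theta = 1 + tau / 6.
Hypotheses (tau_le : tau ^+ 2 * L <= mu) (tau_ge : mu <= 3 * tau * L).

Local Notation gap := (gap (smooth_part Fi Gj) h xs).
Local Notation step := (sock_step (A := A) (B := B) Fi Gj h L tau tau (3 * tau * L)^-1).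
Local Notation a := (1 + 11 / 180 : R).
Local Notation r := (1 - 2 * tau + 11 / 180 * tau).
Local Notation q := (tau * (3 * tau * L + mu) / 2).
Local Notation sqdist z := (enorm (z - xs) ^+ 2).

Let L_gt0 : 0 < L. Proof. exact: lt_le_trans mu_gt0 mu_le_L. Qed.

Let tau_gt0 : 0 < tau. Proof. by rewrite tauE invr_gt0 mulr_gt0. Qed.

Let tau_half : tau <= 2^-1.
Proof. by rewrite tauE lef_pV2 ?posrE ?mulr_gt0// ler_peMr// ler1n. Qed.

Let draw_gt0 : (0 < #|draw (n2 := n2) A B|)%N.
Proof. by rewrite card_prod !card_tuple card_ord muln_gt0 !expn_gt0 n2_gt0. Qed.

Let theta_gt0 : 0 < theta. Proof. by rewrite thetaE; have := tau_gt0; lra. Qed.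

Lemma step_gap xt y z w : (h xt < +oo)%E -> (h y < +oo)%E ->
  let x := tau *: z + tau *: xt + (1 - tau - tau) *: y in
  let e := grad_estimator Fi Gj xt x w - grad (smooth_part Fi Gj) x in
  (h (step xt (y, z) w).1 < +oo)%E /\
  gap (step xt (y, z) w).1 + q * sqdist (step xt (y, z) w).2
  <= tau * gap xt + (1 - 2 * tau) * gap y
     + (3 * tau ^+ 2 * L / 2 + tau * mu / 8) * sqdist z
     + ((4 * L)^-1 + 2 * tau / mu) * enorm e ^+ 2.
Proof.
move=> hxt hy x e.
have := @coupling_step _ _ (smooth_part Fi Gj) h L mu xs
  (differentiable_smooth_part dF dG) cf
  (smooth_fun_smooth_part n1_gt0 n2_gt0 dF dG FG_smooth) mu_gt0 mu_le_L
  h_proper h_lsc h_convex h_mu xs_fin xs_min tau xt y z (grad_estimator Fi Gj xt x w)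
  tau_gt0 tau_half hxt hy.
rewrite /= -/x -/e /sock_step -/x.
have -> : (2 * (3 * tau * L)^-1)^-1 = 3 * tau * L / 2.
  by field; rewrite !gt_eqF.
rewrite -/(grad_estimator Fi Gj xt x w) => -[hy' le1]; split; first exact: hy'.
apply: le_trans le1 _.
(* The weight [4 / mu] charges the bias [mu / 8] per unit of squared distance, a quarter of the
   surplus [mu / 2]. *)
have mu4 : 0 < 4 / mu by rewrite divr_gt0.
have := ler_wpM2l (ltW tau_gt0) (dotv_young e (z - xs) mu4).
rewrite (_ : 4 / mu / 2 = 2 / mu); last by field; rewrite gt_eqF.
rewrite (_ : (2 * (4 / mu))^-1 = mu / 8); last by field; rewrite gt_eqF.
have := ler_wpM2l (ltW tau_gt0) (ler_norm (- dotv e (z - xs))); rewrite normrN.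
move: (dotv e _) (enorm e ^+ 2) (enorm (z - xs) ^+ 2) (gap xt) (gap y) => c E Z Dt D.
rewrite (_ : tau * (2 / mu * E + mu / 8 * Z) = 2 * tau / mu * E + tau * mu / 8 * Z).
  lra.
by ring.
Qed.

Lemma expected_step xt y z : (h xt < +oo)%E -> (h y < +oo)%E ->
  umean (fun w => gap (step xt (y, z) w).1 + q * sqdist (step xt (y, z) w).2)
  <= tau * a * gap xt + r * gap y + q / theta * sqdist z.
Proof.
move=> hxt hy; pose x := tau *: z + tau *: xt + (1 - tau - tau) *: y.
pose E w := enorm (grad_estimator (A := A) (B := B) Fi Gj xt x w
  - grad (smooth_part Fi Gj) x) ^+ 2.
pose base := tau * gap xt + (1 - 2 * tau) * gap y
  + (3 * tau ^+ 2 * L / 2 + tau * mu / 8) * sqdist z.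
pose K := (4 * L)^-1 + 2 * tau / mu.
have K0 : 0 <= K by rewrite addr_ge0 ?invr_ge0 ?divr_ge0 ?mulr_ge0// ltW.
apply: (@le_trans _ _ (umean (fun w => base + K * E w))).
  by apply: umean_le => w; have [] := step_gap z w hxt hy.
rewrite umeanD umean_cst// umeanZ.
(* [11 / 4] is [3 / 4], from [mu <= 3 * tau * L], plus the 2 of the bias; with the factor [1 / 180]
   it becomes [11 / 720]. *)
have Kmu : K * mu ^+ 2 <= 11 / 4 * mu * tau.
  have -> : K * mu ^+ 2 = mu * (mu / (4 * L) + 2 * tau).
    by rewrite /K; field; rewrite !gt_eqF.
  rewrite (_ : 11 / 4 * mu * tau = mu * (11 / 4 * tau)); last by ring.
  rewrite ler_pM2l//.
  suff : mu / (4 * L) <= 3 / 4 * tau by lra.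
  by rewrite ler_pdivrMr ?mulr_gt0//; have := tau_ge; lra.
set X := enorm (x - xt) ^+ 2.
have X0 : 0 <= X by exact: sqr_ge0.
have KE : K * umean E <= 11 / 720 * mu * tau * X.
  have Err := grad_estimator_error n1_gt0 n2_gt0 dF dG F_smooth F_bounded
    G_smooth G_bounded xt x A_gt0 B_gt0.
  have EX : umean E <= mu ^+ 2 / 180 * X.
    apply: le_trans Err _; rewrite -/X ler_wpM2r//.
    by have := lerD B_large A_large; lra.
  have := ler_wpM2l K0 EX; have := ler_wpM2r X0 Kmu; lra.
apply: le_trans (lerD (lexx base) KE) _.
have Xle : X <= 2 * tau * sqdist z + 2 * sqdist y + 2 * sqdist xt.
  have -> : X = enorm (tau *: (z - xt) + (1 - tau - tau) *: (y - xt)) ^+ 2.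
    by congr (enorm _ ^+ 2); apply/rowP => i; rewrite /x !mxE; ring.
  apply: le_trans (sqr_enorm_comb2_le _ _ _ _ _) _; [exact: ltW| | |].
    by have := tau_half; lra.
    by have := tau_gt0; lra.
  have zx (u : 'rV[R]_N2) : enorm (u - xt) ^+ 2 <= 2 * sqdist u + 2 * sqdist xt.
    have -> : u - xt = (u - xs) + (xs - xt) by rewrite addrA subrK.
    by rewrite (le_trans (sqr_enormD_le _ _))// -(enormN (xs - xt)) opprB.
  exact: comb_arith (ltW tau_gt0) tau_half (sqr_ge0 _) (sqr_ge0 _) (zx z) (zx y).
have gap_lb u : (h u < +oo)%E -> mu / 2 * sqdist u <= gap u.
  by apply: gap_ge => //; exact: differentiable_smooth_part.
apply: step_arith tau_gt0 tau_half mu_gt0 tau_le thetaE (sqr_ge0 _) _ _ Xle;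
  exact: gap_lb.
Qed.

(** Bernoulli's inequality in reverse: [(1 + s) ^ k * (1 - k * s) <= 1], taken at
    [m * s = 1 / 12]. *)
Let theta_expm : theta ^+ m <= 12 / 11.
Proof.
have t0 := tau_gt0; have mtau : m%:R * (tau / 6) = 1 / 12.
  by rewrite tauE; field; rewrite pnatr_eq0.
have P k : theta ^+ k * (1 - k%:R * (tau / 6)) <= 1.
  elim: k => [|k IH]; first by rewrite expr0 mul0r subr0 mulr1.
  apply: le_trans IH; rewrite exprSr -mulrA ler_wpM2l ?exprn_ge0 ?(ltW theta_gt0)//.
  have k0 : 0 <= k%:R :> R by [].
  rewrite thetaE -natr1; nra.
by have := P m; rewrite mtau; lra.
Qed.

Let theta_expm_ge : 13 / 12 <= theta ^+ m.
Proof.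
have t0 := tau_gt0; have mtau : m%:R * (tau / 6) = 1 / 12.
  by rewrite tauE; field; rewrite pnatr_eq0.
have P k : 1 + k%:R * (tau / 6) <= theta ^+ k.
  elim: k => [|k IH]; first by rewrite expr0 mul0r addr0.
  rewrite exprSr; apply: le_trans (ler_wpM2r (ltW theta_gt0) IH).
  have k0 : 0 <= k%:R :> R by [].
  rewrite thetaE -natr1; nra.
by have := P m; rewrite mtau; lra.
Qed.

Lemma sock_convergence S x0 : (h x0 < +oo)%E ->
  let out := sock (A := A) (B := B) (S := S) (m := m) Fi Gj h L tau tau theta
               (3 * tau * L)^-1 x0 in
  (forall ws, (h (out ws) < +oo)%E) /\
  umean (fun ws => gap (out ws)) <= 10 * (12 / 13) ^+ S * gap x0.
Proof.
move=> hx0 /=; have t0 := tau_gt0; have t2 := tau_half.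
have gap_ge0' u : (h u < +oo)%E -> 0 <= gap u.
  by apply: (gap_ge0 (mu := mu)) => //; exact: differentiable_smooth_part.
have jens w p := @gap_jensen _ _ (smooth_part Fi Gj) h xs cf h_proper h_convex m' w p.
have stepf xt y z w hxt hy := (@step_gap xt y z w hxt hy).1.
have c0 : 0 <= tau * a by apply: mulr_ge0; lra.
have r0 : 0 <= r by lra.
have q0 : 0 <= q.
  by rewrite divr_ge0// mulr_ge0 ?(ltW t0)// addr_ge0 ?mulr_ge0// ltW.
(* The left side is at most [191 / 165 * tau], the right side at least [319 / 180 * tau]. *)
have contr : tau * a * theta ^+ m <= 1 - r * theta.
  have := ler_wpM2l c0 theta_expm.
  rewrite thetaE; nra.
split=> [ws|].
  by have [] := @epochs_fin _ _ _ step (fun u => (h u < +oo)%E) gap m' theta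
    theta_gt0 jens stepf (x0, (x0, x0)) ws hx0 hx0.
have := @epochs_gap_le _ _ _ step (fun u => (h u < +oo)%E) gap (fun u => sqdist u)
  m' theta (tau * a) r q draw_gt0 theta_gt0 c0 r0 q0 gap_ge0' (fun u => sqr_ge0 _)
  jens stepf expected_step contr S x0 hx0.
rewrite -/m; set Theta := \sum_(j < m) _; set E := umean _.
have E0 : 0 <= E.
  rewrite -[0](mulr0 (#|sock_sample (n2 := n2) m A B S|%:R^-1)) ler_wpM2l ?invr_ge0//.
  apply: sumr_ge0 => ws _; apply: gap_ge0'.
  by have [] := @epochs_fin _ _ _ step (fun u => (h u < +oo)%E) gap m' theta
    theta_gt0 jens stepf (x0, (x0, x0)) ws hx0 hx0.
have ThetaK : 1 / 2 <= tau * a * Theta.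
  have Theta_ge : m%:R <= Theta.
    rewrite -[m in m%:R]card_ord -sumr_const; apply: ler_sum => j _.
    by apply: exprn_ege1; rewrite thetaE; lra.
  have tm : tau * m%:R = 1 / 2 by rewrite tauE; field; rewrite pnatr_eq0.
  have := ler_wpM2l (ltW t0) Theta_ge; rewrite tm => h1.
  by have := mulr_ge0 (ltW t0) (le_trans (ler0n R m) Theta_ge); lra.
have D0 := gap_ge0' _ hx0.
have Zle : mu / 2 * sqdist x0 <= gap x0.
  by apply: (gap_ge (mu := mu)) => //; exact: differentiable_smooth_part.
have qZ : q / theta * sqdist x0 <= 7 / 2 * gap x0.
  have Z0 : 0 <= sqdist x0 by exact: sqr_ge0.
  have qth : q / theta <= q.
    by rewrite ler_pdivrMr// ler_peMr// thetaE; lra.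
  have qmu : q <= 7 / 2 * (mu / 2) by have := tau_le; have := mu_gt0; nra.
  apply: le_trans (ler_wpM2r Z0 (le_trans qth qmu)) _.
  by have := Zle; lra.
have rD : r * gap x0 <= 1 * gap x0 by apply: ler_wpM2r => //; lra.
set K := tau * a * Theta in ThetaK * => H.
have K0 : 0 < K by lra.
have KD := ler_wpM2r D0 ThetaK.
(* The initial potential is at most [K + 1 + 7 / 2] times the gap; dividing by [K >= 1 / 2] gives
   [1 + 2 + 7 = 10]. *)
have TE : theta ^+ m ^+ S * E <= 10 * gap x0.
  by rewrite -(ler_pM2l K0); lra.
have c1213 : 0 <= (12 / 13 : R) by lra.
have TS : (13 / 12) ^+ S * E <= theta ^+ m ^+ S * E.
  by rewrite ler_wpM2r// lerXn2r ?nnegrE// ?exprn_ge0 ?(ltW theta_gt0)//; lra.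
have := ler_wpM2l (exprn_ge0 S c1213) (le_trans TS TE).
rewrite mulrA -exprMn (_ : 12 / 13 * (13 / 12) = 1 :> R); last by field.
by rewrite expr1n mul1r mulrA (mulrC _ 10).
Qed.

End SoCKStep.

(** * Complexity *)

Lemma ceil_nat_bounds (R : realType) (x : R) : 0 <= x ->
  x <= (ceil_nat x)%:R <= x + 1.
Proof.
move=> x0; rewrite /ceil_nat natr_absz ger0_norm ?ceil_ge0; last first.
  by rewrite (lt_le_trans _ x0)// ltrN10.
rewrite ceil_ge/=; have := ltW (ceilB1_lt x).
by rewrite intrB lerBlDr.
Qed.

Lemma maxn1_ceil_nat_bounds (R : realType) (x : R) : 0 <= x ->
  x <= (maxn 1 (ceil_nat x))%:R <= x + 1.
Proof.
move=> x0; have /andP[xc cx] := ceil_nat_bounds x0.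
rewrite natr_max le_max xc orbT/= ge_max cx andbT lerDr//.
Qed.

(** As [12 / 13 <= exp (- 1 / 13)], [65 * M] epochs gain [y ^- 5] with [y = exp M]: one factor
    absorbs [D / eps], and the other four, at least [2 ^ 4 = 16], absorb the 10. *)
Lemma geometric_decay (R : realType) (D eps : R) (S : nat) : 0 <= D -> 0 < eps ->
  65 * Num.max 1 (ln (D / eps)) <= S%:R -> 10 * (12 / 13) ^+ S * D <= eps.
Proof.
move=> D0 eps0; set M := Num.max _ _ => MS.
have M1 : 1 <= M by rewrite le_max lexx.
set y := expR M; have y2 : 2 <= y by have := expR_ge1Dx M; rewrite -/y; lra.
have Dy : D <= y * eps.
  rewrite -ler_pdivrMr//; have [De|De] := ltP 0 (D / eps).
    by rewrite -(lnK De) ler_expR le_max lexx orbT.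
  by apply: le_trans De _; lra.
have c0 : 0 <= (12 / 13 : R) by lra.
have decay : (12 / 13 : R) ^+ S <= y ^- 5.
  have c1 : (12 / 13 : R) <= expR (- (1 / 13)).
    by have := expR_ge1Dx (- (1 / 13) : R); lra.
  have e0 : 0 <= expR (- (1 / 13) : R) by exact: expR_ge0.
  apply: (@le_trans _ _ (expR (- (1 / 13)) ^+ S)).
    by rewrite lerXn2r ?nnegrE.
  rewrite -expRM_natl -exprVn -expRN -expRM_natl ler_expR.
  lra.
have y0 : 0 < y by lra.
have y5 : 0 <= y ^- 5 by rewrite invr_ge0 exprn_ge0// ltW.
have H1 : (12 / 13) ^+ S * D <= y ^- 5 * (y * eps).
  by apply: ler_pM => //; exact: exprn_ge0.
have y4 : 16 <= y ^+ 4.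
  have y22 : 4 <= y ^+ 2 by rewrite expr2; nra.
  by rewrite (_ : y ^+ 4 = y ^+ 2 * y ^+ 2); [nra|ring].
have H2 : y ^- 5 * (y * eps) <= eps / 16.
  rewrite (_ : y ^- 5 * (y * eps) = eps / y ^+ 4); last by field; rewrite gt_eqF.
  rewrite ler_pM2l// lef_pV2// posrE; first by rewrite exprn_gt0.
  lra.
rewrite -mulrA; lra.
Qed.

Lemma natr_sock_complexity (R : realType) (n1 n2 m A B S : nat) :
  (sock_complexity n1 n2 m A B S)%:R
  = S%:R * (n2%:R + n2%:R + n1%:R
            + m%:R * (2 * A%:R + 2 * B%:R + n1%:R + 2)) :> R.
Proof. by rewrite /sock_complexity !(natrM, natrD). Qed.

Fact epoch_count (R : realType) (M : R) : 1 <= M ->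
  exists S : nat, [/\ (0 < S)%N, 65 * M <= S%:R & S%:R <= 66 * M].
Proof.
move=> M1; have M65 : 0 <= 65 * M by lra.
have /andP[MS SM] := ceil_nat_bounds M65.
by exists (ceil_nat (65 * M)); split=> //; [rewrite -(ltr0n R)|]; lra.
Qed.

(** The additive constants from rounding the batches and from the two prox steps sum to 6 and are
    absorbed by [n1 >= 1]; then [4320 = 3 / 2 * 2880]. The 66 is 65 plus the rounding of the epoch
    count, absorbed by [M >= 1]. *)
Fact complexity_arith (R : realType) (n1 n2 m A B S k X M : R) :
  1 <= n1 -> 0 <= n2 -> 0 <= m -> 1 <= k -> 0 <= X -> 1 <= M ->
  0 <= A -> 0 <= B -> 0 <= S ->
  m <= 3 / 2 * k -> A <= 720 * X + 1 -> B <= 720 * X + 1 -> S <= 66 * M ->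
  S * (n2 + n2 + n1 + m * (2 * A + 2 * B + n1 + 2))
  <= 66 * 4320 * ((n1 + n2 + k * (X + n1)) * M).
Proof.
move=> n10 n20 m0 k1 X0 M1 A0 B0 S0 mk AX BX SM.
set W := 2 * A + 2 * B + n1 + 2.
have W0 : 0 <= W by rewrite /W; lra.
have WX : W <= 2880 * X + 7 * n1 by rewrite /W; lra.
have k0 : 0 <= k by lra.
have kX : 0 <= k * X by exact: mulr_ge0.
have kn : 0 <= k * n1 by apply: mulr_ge0 => //; lra.
have mW : m * W <= 4320 * (k * (X + n1)).
  have H1 := ler_wpM2r W0 mk.
  have H2 := ler_wpM2l k0 WX.
  lra.
have T0 : 0 <= n2 + n2 + n1 + m * W.
  by have := mulr_ge0 m0 W0; lra.
have T1 : n2 + n2 + n1 + m * W <= 4320 * (n1 + n2 + k * (X + n1)) by lra.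
have := ler_pM S0 T0 SM T1; lra.
Qed.

Theorem corollary4p5 (R : realType) :
  exists C : R, 0 < C /\
  forall (n1 n2 N1 N2 : nat)
    (Fi : 'I_n1 -> 'rV[R]_N1 -> R)
    (Gj : 'I_n2 -> 'rV[R]_N2 -> 'rV[R]_N1)
    (h : 'rV[R]_N2 -> \bar R)
    (L_F B_F L_G B_G L mu : R)
    (x0 xstar : 'rV[R]_N2) (eps : R)
    (m A B : nat) (tau1 tau2 theta alpha : R),
  (0 < n1)%N -> (0 < n2)%N ->
  (forall i u, differentiable (Fi i) u) ->
  (forall j x, differentiable (Gj j) x) ->
  proper_fun h -> lower_semicontinuous h -> ext_convex h ->
  convex_function [set: convex_lmodType 'rV[R]_N2] (smooth_part Fi Gj) ->
  0 < mu -> strongly_convex mu h ->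
  (forall i, smooth_fun L_F (Fi i)) ->
  (forall i, bounded_grad B_F (Fi i)) ->
  (forall j, smooth_map L_G (Gj j)) ->
  (forall j, bounded_jacobian B_G (Gj j)) ->
  (forall i j x y,
     enorm (grad (Fi i) (avg_map Gj x) *m ('J (Gj j) x)^T
            - grad (Fi i) (avg_map Gj y) *m ('J (Gj j) y)^T)
       <= L * enorm (x - y)) ->
  mu <= L ->
  minimizer (objective Fi Gj h) xstar ->
  0 < eps ->
  (h x0 < +oo)%E ->
  m = ceil_nat (2^-1 * Num.sqrt (L / mu)) ->
  tau1 = (2 * m%:R)^-1 ->
  tau2 = (2 * m%:R)^-1 ->
  theta = 1 + (12 * m%:R)^-1 ->
  alpha = (3 * tau1 * L)^-1 ->
  A = maxn 1 (ceil_nat (720 * B_G ^+ 4 * L_F ^+ 2 / mu ^+ 2)) ->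
  B = maxn 1 (ceil_nat (720 * B_F ^+ 2 * L_G ^+ 2 / mu ^+ 2)) ->
  exists S : nat,
    [/\ (0 < S)%N,
        (expectation_unif (fun w : sock_sample (n2 := n2) m A B S =>
           objective Fi Gj h (sock Fi Gj h L tau1 tau2 theta alpha x0 w)
             - objective Fi Gj h xstar) <= eps%:E)%E
      & (sock_complexity n1 n2 m A B S)%:R
          <= C * ((n1%:R + n2%:R
                   + Num.sqrt (L / mu)
                     * (Num.max (B_G ^+ 4 * L_F ^+ 2) (B_F ^+ 2 * L_G ^+ 2)
                        / mu ^+ 2 + n1%:R))
                  * Num.max 1 (ln (fine (objective Fi Gj h x0
                                         - objective Fi Gj h xstar)%E
                                   / eps)))].
Proof.
exists (66 * 4320); split; first by apply: mulr_gt0; lra.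
move=> n1 n2 N1 N2 Fi Gj h L_F B_F L_G B_G L mu x0 xs eps m A B tau1 tau2 theta alpha.
move=> n1_gt0 n2_gt0 dF dG h_proper h_lsc h_convex cf mu0 h_mu Fs Fb Gs Gb FGs muL.
move=> xs_min eps0 hx0 mE -> -> thetaE -> AE BE.
set k := Num.sqrt (L / mu) in mE *.
have k1 : 1 <= k by rewrite -[1]sqrtr1 ler_wsqrtr// ler_pdivlMr// mul1r.
have LE : L = k ^+ 2 * mu.
  rewrite sqr_sqrtr ?divfK ?gt_eqF// divr_ge0 ?(ltW mu0)//.
  exact: le_trans (ltW mu0) muL.
have k2 : 0 <= 2^-1 * k by lra.
have /andP[km mk] := ceil_nat_bounds k2.
rewrite -mE in km mk.
have m_gt0 : (0 < m)%N by rewrite -(ltr0n R); lra.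
case: m => [//|m'] in mE thetaE km mk m_gt0 *.
set m := m'.+1 in mE thetaE km mk m_gt0 *.
set tau := (2 * m%:R)^-1.
have mR : 0 < m%:R :> R by rewrite ltr0n.
have mk' : m%:R <= 3 / 2 * k by lra.
have tau0 : 0 < tau by rewrite invr_gt0; lra.
(* Rounding up gives [k / 2 <= m <= 3 / 2 * k], so [tau * k] lies between [1 / 3] and 1; both bounds
   on [tau] follow from [L = k ^+ 2 * mu]. *)
have tk : tau * k <= 1.
  by rewrite mulrC ler_pdivrMr ?mul1r; lra.
have tk3 : 1 <= 3 * (tau * k).
  by rewrite (mulrC tau) mulrA ler_pdivlMr ?mul1r; lra.
have tau_le : tau ^+ 2 * L <= mu.
  rewrite LE mulrA -exprMn ler_piMl ?(ltW mu0)// expr_le1//.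
  by apply: mulr_ge0; lra.
have tau_ge : mu <= 3 * tau * L.
  have h1 : mu <= k * mu by rewrite ler_peMl// ltW.
  have h2 : k * mu <= 3 * (tau * k) * (k * mu) by rewrite ler_peMl//; lra.
  by rewrite LE expr2; lra.
have thetaE' : theta = 1 + tau / 6.
  by rewrite thetaE /tau; congr (_ + _); field; rewrite gt_eqF.
set P := B_G ^+ 4 * L_F ^+ 2 in AE *; set Q := B_F ^+ 2 * L_G ^+ 2 in BE *.
have P0 : 0 <= P by rewrite mulr_ge0 ?sqr_ge0// (exprM _ 2 2) sqr_ge0.
have Q0 : 0 <= Q by rewrite mulr_ge0 ?sqr_ge0.
have mu2 : 0 < mu ^+ 2 by rewrite exprn_gt0.
have batch (C : R) (n : nat) : 0 <= C -> n = maxn 1 (ceil_nat (720 * C / mu ^+ 2)) ->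
    [/\ (0 < n)%N, C / n%:R <= mu ^+ 2 / 720 & n%:R <= 720 * (C / mu ^+ 2) + 1].
  move=> C0 nE.
  have Cmu : 0 <= 720 * C / mu ^+ 2.
    by apply: divr_ge0; [apply: mulr_ge0; [lra|]|exact: ltW].
  have n_gt0 : (0 < n)%N by rewrite nE leq_max.
  have := maxn1_ceil_nat_bounds Cmu; rewrite -nE => /andP[Cn nC]; split=> //.
    rewrite ler_pdivrMr// in Cn; rewrite ler_pdivrMr ?ltr0n//.
    lra.
  by rewrite mulrA.
have [A_gt0 A_large A_le] : [/\ (0 < A)%N, P / A%:R <= mu ^+ 2 / 720 &
    A%:R <= 720 * (P / mu ^+ 2) + 1] by apply: batch => //; rewrite AE /P mulrA.
have [B_gt0 B_large B_le] : [/\ (0 < B)%N, Q / B%:R <= mu ^+ 2 / 720 &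
    B%:R <= 720 * (Q / mu ^+ 2) + 1] by apply: batch => //; rewrite BE /Q mulrA.
have xs_fin : (h xs < +oo)%E.
  have := xs_min x0; rewrite /objective -(proper_fineK h_proper hx0) -EFinD.
  by case: (h xs) => // r _; exact: ltry.
set f := smooth_part Fi Gj in cf.
(* Every sampled output has finite [h], so the extended-real expectation in the statement becomes a
   real mean of gaps. *)
have objE u : (h u < +oo)%E -> (objective Fi Gj h u - objective Fi Gj h xs)%E
    = (gap f h xs u)%:E.
  move=> hu; rewrite /objective -(proper_fineK h_proper hu).
  by rewrite -(proper_fineK h_proper xs_fin) -!EFinD.
have conv S := @sock_convergence R n1 n2 N1 N2 Fi Gj h L_F B_F L_G B_G L mu xs
  n1_gt0 n2_gt0 dF dG h_proper h_lsc h_convex cf mu0 h_mu Fs Fb Gs Gb FGs muL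
  xs_fin xs_min m' A B tau theta A_gt0 B_gt0 A_large B_large erefl thetaE'
  tau_le tau_ge S x0 hx0.
have D0 : 0 <= gap f h xs x0.
  by apply: (gap_ge0 (mu := mu)) => //; exact: differentiable_smooth_part.
rewrite (objE x0 hx0) /=; set D := gap f h xs x0 in D0 *.
set M := Num.max 1 (ln (D / eps)).
have M1 : 1 <= M by rewrite le_max lexx.
have [S [S_gt0 MS SM]] := epoch_count M1.
exists S; have [out_fin out_le] := conv S; split=> //.
- rewrite (_ : (fun w => _) = (fun w => (gap f h xs
    (sock (S := S) (m := m) Fi Gj h L tau tau theta (3 * tau * L)^-1 x0 w))%:E)).
    rewrite expectation_unifE lee_fin; apply: le_trans out_le _.
    exact: geometric_decay.
  by apply/funext => w; rewrite objE.
rewrite natr_sock_complexity.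
apply: complexity_arith => //.
- by rewrite ler1n.
- by apply: divr_ge0; [rewrite le_max P0|exact: ltW].
- apply: le_trans A_le _; rewrite lerD2r; apply: ler_wpM2l; first exact: ler0n.
  by rewrite ler_wpM2r ?invr_ge0 ?(ltW mu2)// le_max lexx.
- apply: le_trans B_le _; rewrite lerD2r; apply: ler_wpM2l; first exact: ler0n.
  by rewrite ler_wpM2r ?invr_ge0 ?(ltW mu2)// le_max lexx orbT.
Qed.
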